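(* Let $(X,f)$ be a zero-dimensional system of finite topological rank such that no minimal set of $(X,f)$ is an odometer. Then $(X,f)$ is expansive.
   Context: Zero-dimensional system: a pair $(X,f)$ where $X$ is a compact zero-dimensional metrizable space and $f:X\to X$ is a homeomorphism. Bratteli diagram: an infinite directed graph $(V,E)$ with partitions into non-empty disjoint finite sets $V=V_0\cup V_1\cup V_2\cup\cdots$, $E=E_1\cup E_2\cup\cdots$, where $V_0=\{v_0\}$ is a single point, with source and range maps $s:E_n\to V_{n-1}$, $r:E_n\to V_n$ ($n\ge 1$), such that $s^{-1}(v)\neq\emptyset$ for all $v\in V$ and $r^{-1}(v)\neq\emptyset$ for all $v\in V\setminus V_0$. Multiple edges are allowed. Its rank is $\liminf_{n\to\infty}\# V_n$. Ordered Bratteli diagram $(V,E,\le)$: a Bratteli diagram with a partial order on $E$ such that $e,e'$ are comparable if and only if $r(e)=r(e')$; i.e. a linear order on each $r^{-1}(v)$, $v\in V\setminus V_0$. An edge is maximal (minimal) if it is maximal (minimal) in $r^{-1}(r(e))$. Bratteli–Vershik system: let $E_{0,\infty}\subseteq\prod_{i\ge1}E_i$ be the space of infinite paths $(e_1,e_2,\dots)$ starting from $v_0$ (with $r(e_i)=s(e_{i+1})$), with the subspace topology of the product of discrete spaces. Let $E_{0,\infty,\max}$ (resp. $E_{0,\infty,\min}$) be the set of paths all of whose edges are maximal (resp. minimal). Given a bijection $\phi:E_{0,\infty,\max}\to E_{0,\infty,\min}$, extend it to $\phi:E_{0,\infty}\to E_{0,\infty}$ as follows: for $e=(e_1,e_2,\dots)\notin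 E_{0,\infty,\max}$, let $n$ be least such that $e_n$ is not maximal, let $f_n$ be the successor of $e_n$ in $r^{-1}(r(e_n))$, let $(f_1,\dots,f_{n-1})$ be the unique path from $v_0$ to $s(f_n)$ consisting of minimal edges, and set $\phi(e)=(f_1,\dots,f_{n-1},f_n,e_{n+1},e_{n+2},\dots)$. If the resulting $\phi$ is a homeomorphism, it is called a Vershik map and $(E_{0,\infty},\phi)$ is a Bratteli–Vershik system of $(V,E,\le)$. A Bratteli–Vershik representation of $(X,f)$ is a Bratteli–Vershik system topologically conjugate to $(X,f)$. The topological rank of $(X,f)$ is the minimum $K\in\{1,2,\dots,\infty\}$ such that $(X,f)$ has a Bratteli–Vershik representation with an ordered Bratteli diagram of rank $K$. A minimal set is a non-empty closed set $M\subseteq X$ with $f(M)=M$ having no proper non-empty closed $f$-invariant subset. Odometers are always infinite: an odometer is a system topologically conjugate to the translation by $1$ on an infinite inverse limit $\varprojlim \mathbb{Z}/n_k\mathbb{Z}$ with $n_k\mid n_{k+1}$ and $n_k\to\infty$; a minimal set $M$ is an odometer if $(M,f|_M)$ is. Expansive: for a compatible metric $d$ on $X$ there is $\varepsilon>0$ such that for all $x\ne y$ in $X$ there is $n\in\mathbb{Z}$ with $d(f^n(x),f^n(y))>\varepsilon$. *)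

(* Defs.v *)
From HB Require Import structures.
From mathcomp Require Import all_boot all_order all_algebra.
From mathcomp Require Import all_classical all_reals all_analysis.

Set Implicit Arguments.
Unset Strict Implicit.
Unset Printing Implicit Defensive.

Import Order.TTheory GRing.Theory Num.Theory.
Import numFieldNormedType.Exports.

Local Open Scope classical_set_scope.
Local Open Scope ring_scope.

Record homeo (X Y : topologicalType) := Homeo {
  homeo_fun :> X -> Y;
  homeo_inv : Y -> X;
  homeo_funK : cancel homeo_fun homeo_inv;
  homeo_invK : cancel homeo_inv homeo_fun;
  homeo_fun_continuous : continuous homeo_fun;
  homeo_inv_continuous : continuous homeo_inv }.

Definition iterz (X : topologicalType) (f : homeo X X) (n : int) : X -> X :=
  match n with
  | Posz k => iter k f
  | Negz k => iter k.+1 (homeo_inv f)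
  end.

Definition conjugate (X Y : topologicalType) (f : X -> X) (g : Y -> Y) :=
  exists h : homeo X Y, forall x, h (f x) = g (h x).

Definition expansive (R : realType) (X : metricType R) (f : homeo X X) :=
  exists2 eps : R, 0 < eps &
    forall x y : X, x <> y ->
      exists n : int, eps < mdist (iterz f n x) (iterz f n y).

Definition closed_invariant (X : topologicalType) (f : X -> X) (M : set X) :=
  [/\ M !=set0, closed M & f @` M = M].

Definition minimal_set (X : topologicalType) (f : X -> X) (M : set X) :=
  closed_invariant f M /\
  forall N : set X, closed_invariant f N -> N `<=` M -> N = M.

(* No positivity is required of the moduli: a zero modulus would force all
   later ones to vanish, against the divergence. *)
Record scale := Scale {
  scale_fun :> nat -> nat;
  scale_dvd : forall k, (scale_fun k %| scale_fun k.+1)%N;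
  scale_cvg : scale_fun k @[k --> \oo] --> \oo }.

Definition odometer_set (n : scale) :
    set (prod_topology (fun k => discrete_topology 'I_(n k))) :=
  [set x | forall k, (x k.+1 : 'I_(n k.+1)) = (x k : 'I_(n k)) %[mod n k]].

Definition odometer_space (n : scale) : topologicalType :=
  set_type (@odometer_set n).

Lemma odometer_succ_subproof (n : scale) (x : odometer_space n) :
  (fun k => ordS (val x k)) \in @odometer_set n.
Proof.
apply/mem_set => k /=; rewrite modn_dvdm ?scale_dvd//.
have /(_ k) xk := set_valP x.
by rewrite modn_mod -addn1 -modnDml xk modnDml addn1.
Qed.

Definition odometer_succ (n : scale) (x : odometer_space n) :
  odometer_space n := SigSub (odometer_succ_subproof x).

Definition odometer (X : topologicalType) (f : X -> X) :=
  exists n : scale, conjugate f (@odometer_succ n).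

Definition odometer_on (X : topologicalType) (f : X -> X) (M : set X) :=
  exists2 g : set_type M -> set_type M,
    (forall x, val (g x) = f (val x)) & odometer g.

(* [edge n] is the edge set E_(n+1), joining level n to level n+1. *)
Record bratteli := Bratteli {
  vertex : nat -> finType;
  edge : nat -> finType;
  src : forall n, edge n -> vertex n;
  tgt : forall n, edge n -> vertex n.+1;
  vertex_gt0 : forall n, (0 < #|vertex n|)%N;
  edge_gt0 : forall n, (0 < #|edge n|)%N;
  vertex0 : #|vertex 0| = 1%N;
  src_surj : forall n (v : vertex n), exists e : edge n, src e = v;
  tgt_surj : forall n (v : vertex n.+1), exists e : edge n, tgt e = v }.

Record ordered_bratteli := OrderedBratteli {
  diagram :> bratteli;
  edge_le : forall n, rel (edge diagram n);
  edge_le_refl : forall n, reflexive (@edge_le n);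
  edge_le_anti : forall n, antisymmetric (@edge_le n);
  edge_le_trans : forall n, transitive (@edge_le n);
  edge_le_comparable : forall n (e e' : edge diagram n),
    edge_le e e' || edge_le e' e <-> tgt e = tgt e' }.

Definition bratteli_rank (R : realType) (B : bratteli) : \bar R :=
  limn_einf (fun n => (#|vertex B n|%:R)%:E).

Definition maximal_edge (B : ordered_bratteli) n (e : edge B n) :=
  forall e' : edge B n, tgt e' = tgt e -> edge_le e e' -> e' = e.

Definition minimal_edge (B : ordered_bratteli) n (e : edge B n) :=
  forall e' : edge B n, tgt e' = tgt e -> edge_le e' e -> e' = e.

Definition successor_edge (B : ordered_bratteli) n (e e' : edge B n) :=
  [/\ tgt e' = tgt e, edge_le e e', e' <> e &
    forall e'' : edge B n, tgt e'' = tgt e -> edge_le e e'' -> e'' <> e ->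
      edge_le e' e''].

Definition path_set (B : bratteli) :
    set (prod_topology (fun n => discrete_topology (edge B n))) :=
  [set p | forall n, tgt (p n : edge B n) = src (p n.+1 : edge B n.+1)].

Definition path_space (B : bratteli) : topologicalType :=
  set_type (@path_set B).

Definition path_edge (B : bratteli) (p : path_space B) n : edge B n :=
  val p n.

Definition max_paths (B : ordered_bratteli) : set (path_space B) :=
  [set p | forall n, maximal_edge (path_edge p n)].

Definition min_paths (B : ordered_bratteli) : set (path_space B) :=
  [set p | forall n, minimal_edge (path_edge p n)].

(* On a non-maximal path the last clause determines [phi p]: as [phi p] is a
   path, its minimal edges below level [n] form the unique path of minimal
   edges leading to the source of the successor edge. *)
Definition vershik_map (B : ordered_bratteli)
    (phi : path_space B -> path_space B) :=
  set_bij (@max_paths B) (@min_paths B) phi /\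
  forall (p : path_space B) n,
    (forall i, (i < n)%N -> maximal_edge (path_edge p i)) ->
    ~ maximal_edge (path_edge p n) ->
    [/\ forall i, (i < n)%N -> minimal_edge (path_edge (phi p) i),
        successor_edge (path_edge p n) (path_edge (phi p) n) &
        forall i, (n < i)%N -> path_edge (phi p) i = path_edge p i].

Definition bratteli_vershik_representation (X : topologicalType)
    (f : X -> X) (B : ordered_bratteli) :=
  exists phi : homeo (path_space B) (path_space B),
    vershik_map phi /\ conjugate f phi.

(* Ranks are positive integers or +oo, so the infimum is a minimum as soon as
   [f] has a representation; it is +oo otherwise. *)
Definition topological_rank (R : realType) (X : topologicalType)
    (f : X -> X) : \bar R :=
  ereal_inf [set K | exists2 B : ordered_bratteli,
    bratteli_vershik_representation f B & bratteli_rank R B = K].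

(* Main.v *)
Require Import Defs.
From mathcomp Require Import all_boot all_order all_algebra.
From mathcomp Require Import all_classical all_reals all_analysis.
From mathcomp Require Import zify.

(* At level [n] of the diagram, the orbit of a point is read as a bi-infinite
concatenation of towers, its row; rows of higher levels are mapped to rows of
lower levels by substitutions, and finite rank means that infinitely many levels
use at most [K] towers.  If the system is not expansive, then for every [n] two
distinct points have the same row of level [n].

Factoring the substitutions between levels through alphabets of least cardinality
makes them elementary from some level [N] on, and an elementary substitution is
recognizable on aperiodic sequences.  Hence a row of level [n >= N] shared by two
distinct points is periodic.  Minimal sets are at most [K] in number, since
disjoint ones use different towers at high levels; so one minimal set [M] has, for
infinitely many [n], only points whose row is a shift of such a periodic row.  Thus
all the rows of [M] are periodic: either their periods are unbounded and [M] is an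
odometer, or [M] is a periodic orbit.  The latter is excluded, because the points
that follow a periodic orbit up to level [n] and no further would need, for
different [n], different towers at a common higher level. *)

Set Implicit Arguments.
Unset Strict Implicit.
Unset Printing Implicit Defensive.

Import Order.TTheory GRing.Theory Num.Theory.
Import numFieldNormedType.Exports.

(** * Words and rows *)

Section Words.
Variables (B : Type) (h : B -> nat).

Definition expand (w : seq B) : seq (B * nat) :=
  flatten [seq [seq (b, i) | i <- iota 0 (h b)] | b <- w].

Lemma expand_cat u v : expand (u ++ v) = expand u ++ expand v.
Proof. by rewrite /expand map_cat flatten_cat. Qed.

Lemma expand_cons b w :
  expand (b :: w) = [seq (b, i) | i <- iota 0 (h b)] ++ expand w.
Proof. by []. Qed.

Lemma size_expand1 b : size (expand [:: b]) = h b.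
Proof. by rewrite expand_cons cats0 size_map size_iota. Qed.

Lemma expand_locate w o : o < size (expand w) ->
  exists w1 b w2 i, [/\ w = w1 ++ b :: w2, i < h b & o = size (expand w1) + i].
Proof.
elim: w o => [//|b w IH] o; rewrite expand_cons size_cat size_map size_iota.
case: (ltnP o (h b)) => [ob _|ob]; first by exists [::], b, w, o.
rewrite -ltn_subLR// => /IH[w1 [b' [w2 [i [-> ib oE]]]]].
exists (b :: w1), b', w2, i; split => //.
by rewrite expand_cons size_cat size_map size_iota; lia.
Qed.

Lemma nth_expand d w1 b w2 i : i < h b ->
  nth d (expand (w1 ++ b :: w2)) (size (expand w1) + i) = (b, i).
Proof.
move=> ib; rewrite expand_cat nth_cat ltnNge leq_addr/= addKn expand_cons.
rewrite nth_cat size_map size_iota ib (nth_map 0) ?size_iota//.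
by rewrite nth_iota// add0n.
Qed.

Hypothesis h_gt0 : forall b, 0 < h b.

Lemma size_expand_gt0 w : w <> [::] -> 0 < size (expand w).
Proof.
case: w => // b w _; rewrite expand_cons size_cat size_map size_iota.
by have := h_gt0 b; lia.
Qed.

Lemma nth_expand_head d b w : nth d (expand (b :: w)) 0 = (b, 0).
Proof. exact: (@nth_expand d [::] b w 0 (h_gt0 b)). Qed.

Lemma nth_expand_last d b w :
  nth d (expand (rcons w b)) (size (expand (rcons w b))).-1 = (b, (h b).-1).
Proof.
have hb := h_gt0 b.
rewrite -cats1 expand_cat size_cat size_expand1 -expand_cat.
have -> : (size (expand w) + h b).-1 = size (expand w) + (h b).-1 by lia.
by apply: nth_expand; lia.
Qed.

(** The label of the first position names the first letter, whose height then tells where the next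
    letter starts; so the words can be compared letter by letter from the left. *)
Lemma expand_prefix u v : size (expand u) <= size (expand v) ->
  expand u = take (size (expand u)) (expand v) -> exists w, v = u ++ w.
Proof.
elim: u v => [|b u IH] v; first by exists v.
case: v => [|b' v].
  by have := @size_expand_gt0 (b :: u) ltac:(by []) => /=; lia.
have hb := h_gt0 b; move=> sz e.
have : nth (b, 0) (expand (b :: u)) 0
       = nth (b, 0) (take (size (expand (b :: u))) (expand (b' :: v))) 0.
  by rewrite -e.
rewrite nth_take ?size_expand_gt0// !nth_expand_head => -[bE].
move: sz e; rewrite -{b'}bE !expand_cons !size_cat !size_map !size_iota.
rewrite leq_add2l => sz; rewrite takeD take_size_cat ?size_map ?size_iota//.
rewrite drop_size_cat ?size_map ?size_iota// => /(congr1 (drop (h b))).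
rewrite !drop_size_cat ?size_map ?size_iota// => e.
by have [w ->] := IH v sz e; exists w.
Qed.

End Words.

Definition subst (C B : Type) (s : C -> seq B) (w : seq C) : seq B :=
  flatten (map s w).

Definition lift_height (C B : Type) (h : B -> nat) (s : C -> seq B) (c : C) :=
  size (expand h (s c)).

(** The position [x] of an upper row as seen one level below. The default value [d] is returned only
    past the height of [x.1], hence never along a row. *)
Definition proj (C B : Type) (h : B -> nat) (s : C -> seq B) (d : B * nat)
  (x : C * nat) : B * nat := nth d (expand h (s x.1)) x.2.

(* A letter [b] occupies [h b] consecutive positions, labelled [(b, 0)] to
   [(b, (h b).-1)]; so a row is a bi-infinite word, read position by position. *)
Definition step (B : Type) (h : B -> nat) (x y : B * nat) : Prop :=
  x.2 < h x.1 /\ if x.2.+1 < h x.1 then y = (x.1, x.2.+1) else y.2 = 0.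

Definition row (B : Type) (h : B -> nat) (r : int -> B * nat) : Prop :=
  forall n, step h (r n) (r (n + 1)%R).

Definition nonerasing (C B : Type) (s : C -> seq B) := forall c, s c <> [::].

Section SubstWords.
Variables (B C : Type).

Lemma subst_cons (s : C -> seq B) c w : subst s (c :: w) = s c ++ subst s w.
Proof. by []. Qed.

Lemma subst_cat (s : C -> seq B) u v : subst s (u ++ v) = subst s u ++ subst s v.
Proof. by rewrite /subst map_cat flatten_cat. Qed.

Lemma subst1 (s : C -> seq B) c : subst s [:: c] = s c.
Proof. exact: cats0. Qed.

Lemma subst_neq_nil (s : C -> seq B) w :
  nonerasing s -> w <> [::] -> subst s w <> [::].
Proof.
by case: w => // c w sne _; rewrite subst_cons; have := sne c; case: (s c).
Qed.

End SubstWords.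

Section Subst.
Variables (B C D : Type) (h : B -> nat).

Lemma subst_comp (s : C -> seq B) (t : D -> seq C) w :
  subst s (subst t w) = subst (fun x => subst s (t x)) w.
Proof. by elim: w => // x w IH; rewrite subst_cons subst_cat IH. Qed.

Lemma expand_subst (s : C -> seq B) d w :
  expand h (subst s w) = map (proj h s d) (expand (lift_height h s) w).
Proof.
elim: w => // c w IH; rewrite subst_cons expand_cat expand_cons map_cat -IH.
congr (_ ++ _); rewrite -map_comp -[LHS]take_size.
by rewrite -(map_nth_iota0 d).
Qed.

Lemma size_expand_subst (s : C -> seq B) w :
  size (expand h (subst s w)) = size (expand (lift_height h s) w).
Proof.
case: w => // c w; case E: (s c) => [|b v]; last first.
  by rewrite (@expand_subst _ (b, 0)) size_map.
elim: (c :: w) => // {E}c' {}w IH.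
rewrite subst_cons expand_cat size_cat IH expand_cons size_cat.
by rewrite size_map size_iota.
Qed.

Lemma lift_height_comp (s : C -> seq B) (t : D -> seq C) :
  lift_height (lift_height h s) t = lift_height h (fun x => subst s (t x)).
Proof. by apply/funext => x; rewrite /lift_height size_expand_subst. Qed.

Lemma proj_comp (s : C -> seq B) (t : D -> seq C) d e x :
  x.2 < lift_height (lift_height h s) t x.1 ->
  proj h (fun x => subst s (t x)) d x = proj h s d (proj (lift_height h s) t e x).
Proof.
by move=> xh; rewrite /proj (expand_subst _ d) (nth_map e).
Qed.

Hypothesis h_gt0 : forall b, 0 < h b.

Lemma lift_height_gt0 (s : C -> seq B) :
  nonerasing s -> forall c, 0 < lift_height h s c.
Proof. by move=> sne c; apply: size_expand_gt0. Qed.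

(** At the end of a lower letter, the next one either follows in the same word [s c] or begins the
    next word, which is nonempty; in both cases the offset returns to 0. *)
Lemma proj_step (s : C -> seq B) d x y : nonerasing s ->
  step (lift_height h s) x y -> step h (proj h s d x) (proj h s d y).
Proof.
case: x => c o sne [/= oc E].
have [w1 [b [w2 [i [sE ib oE]]]]] := expand_locate oc.
have -> : proj h s d (c, o) = (b, i) by rewrite /proj /= sE oE nth_expand.
split => //=; case: ltnP => ib1.
  rewrite ifT in E; last first.
    rewrite /lift_height sE oE expand_cat size_cat expand_cons size_cat.
    by rewrite size_map size_iota; lia.
  by rewrite E /proj /= sE oE -addnS nth_expand.
have {}oE : o.+1 = size (expand h (rcons w1 b)).
  by rewrite -cats1 expand_cat size_cat size_expand1 oE; lia.
case: ifP E => [lt ->|_].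
  move: lt; rewrite /lift_height sE -cat_rcons expand_cat size_cat -oE.
  case: w2 sE => [|b' w2] sE; first by rewrite /=; lia.
  move=> _; rewrite /proj/= sE -cat_rcons oE -[size _]addn0 nth_expand//.
case: y => c' o' /= ->; rewrite /proj/=.
by case: (s c') (sne c') => // b' w' _; rewrite nth_expand_head.
Qed.

Lemma row_proj (s : C -> seq B) d r : nonerasing s ->
  row (lift_height h s) r -> row h (fun n => proj h s d (r n)).
Proof. by move=> sne rr n; exact: proj_step. Qed.

End Subst.

Lemma proj_cut (B C : Type) (h : B -> nat) (s : C -> seq B) d x :
  (forall b, 0 < h b) -> nonerasing s -> x.2 = 0 -> (proj h s d x).2 = 0.
Proof.
move=> h_gt0 sne; case: x => c o /= ->; rewrite /proj /=.
by case: (s c) (sne c) => // b w _; rewrite nth_expand_head.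
Qed.

Lemma proj_last (B C : Type) (h : B -> nat) (s : C -> seq B) d c o w x :
  (forall b, 0 < h b) -> s c = rcons w x -> o.+1 = lift_height h s c ->
  (proj h s d (c, o)).1 = x.
Proof.
move=> h_gt0 sE oE; rewrite /proj /= sE.
have -> : o = (size (expand h (rcons w x))).-1 by rewrite -sE -[size _]oE.
by rewrite nth_expand_last.
Qed.

Section Row.
Variables (B : Type) (h : B -> nat) (r : int -> B * nat).
Hypothesis rowr : row h r.

Lemma row_lt n : (r n).2 < h (r n).1.
Proof. by have [] := rowr n. Qed.

Lemma row_forward n c o k : r n = (c, o) -> o + k < h c ->
  r (n + k%:Z)%R = (c, o + k).
Proof.
move=> rn; elim: k => [|k IH] lt; first by rewrite addr0 addn0.
have [] := rowr (n + k%:Z)%R; rewrite IH/=; last by lia.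
move=> _; rewrite ifT ?addnS; last by lia.
by move=> <-; congr r; lia.
Qed.

Lemma row_back n c o : r n = (c, o.+1) -> r (n - 1)%R = (c, o).
Proof.
move=> rn; have [] := rowr (n - 1)%R; rewrite subrK rn.
case: (r (n - 1)%R) => c' o' /= _.
by case: ifP => // _ [-> ->].
Qed.

Lemma row_backward n c o k : r n = (c, o) -> k <= o ->
  r (n - k%:Z)%R = (c, o - k).
Proof.
move=> rn; elim: k => [|k IH] le; first by rewrite subr0 subn0.
have -> : (n - k.+1%:Z = n - k%:Z - 1)%R by lia.
by apply: row_back; rewrite IH; [congr pair|]; lia.
Qed.

Lemma row_back_cut n : (r n).2 = 0 -> (r (n - 1)%R).2.+1 = h (r (n - 1)%R).1.
Proof.
move=> rn; have [lt] := rowr (n - 1)%R; rewrite subrK.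
by case: ifP => [_ rE|]; [rewrite rE in rn|lia].
Qed.

Lemma row_next_cut n c : r n = (c, 0) -> (r (n + (h c)%:Z)%R).2 = 0.
Proof.
move=> rn; have := row_lt n; rewrite rn/= => hc.
have rn1 : r (n + (h c).-1%:Z)%R = (c, (h c).-1).
  by rewrite (row_forward rn) ?add0n//; lia.
have [] := rowr (n + (h c).-1%:Z)%R; rewrite rn1/= => _.
rewrite ifF; last by lia.
by move=> <-; congr (r _).2; lia.
Qed.

Lemma row_tower n c o o' : r n = (c, o) -> o' < h c -> exists n', r n' = (c, o').
Proof.
move=> rn o'c; exists (n - o%:Z + o'%:Z)%R.
have rn0 : r (n - o%:Z)%R = (c, 0) by rewrite (row_backward rn)// subnn.
by rewrite (row_forward rn0).
Qed.

Lemma row_cut : exists n, (r n).2 = 0.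
Proof.
exists (0 - (r 0%R).2%:Z)%R.
by rewrite (@row_backward 0%R (r 0%R).1 (r 0%R).2) ?subnn//; case: (r 0%R).
Qed.

End Row.

(** * Elimination of letters *)

Section Elimination.
Variables (B : Type) (h : B -> nat) (d : B * nat).
Hypothesis h_gt0 : forall b, 0 < h b.

(** The measure for the induction on eliminations: it drops even when the number of letters does
    not. *)
Definition total_size (C : finType) (s : C -> seq B) := \sum_c size (s c).

(* Identifies [b] with [a] when their images coincide, and otherwise replaces
   [b] by the word [a b]. *)
Lemma elimination_step (C : finType) (s : C -> seq B) (r r' : int -> C * nat)
    (n1 : int) (a b : C) :
  nonerasing s -> row (lift_height h s) r -> row (lift_height h s) r' ->
  r n1 = (a, 0) -> r' n1 = (b, 0) -> a <> b ->
  size (expand h (s a)) <= size (expand h (s b)) ->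
  (forall n, (n1 <= n)%R -> proj h s d (r n) = proj h s d (r' n)) ->
  exists (D : finType) (t : C -> seq D) (u : D -> seq B),
    [/\ s = (fun c => subst u (t c)), nonerasing t, nonerasing u,
        (forall x, exists c w, t c = rcons w x) & total_size u < total_size s] /\
    (#|D| < #|C| \/ #|D| = #|C| /\ forall e, exists2 n, (n1 <= n)%R &
       proj (lift_height h u) t e (r n) <> proj (lift_height h u) t e (r' n)).
Proof.
move=> sne rowr rowr' ra rb' ab le_ab agree.
(* Both rows start a letter at [n1] and have the same projection from there on, so the expansion of
   [s a], being no longer, begins that of [s b]. *)
have [w sbE] : exists w, s b = s a ++ w.
  apply: (@expand_prefix _ h) => //.
  apply: (@eq_from_nth _ d) => [|i ia]; first by rewrite size_takel.
  have := agree (n1 + i%:Z)%R ltac:(lia).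
  rewrite (row_forward rowr ra) ?add0n//.
  rewrite (row_forward rowr' rb') ?add0n//; last first.
    by rewrite /lift_height; lia.
  by rewrite /proj /= => ->; rewrite nth_take.
case: w sbE => [|b0 w] sbE.
  rewrite cats0 in sbE.
  have a_b : a != b by apply/eqP.
  pose D : finType := {x : C | x != b}.
  pose t c : seq D := [:: insubd (exist _ a a_b : D) c].
  exists D, t, (fun x => s (val x)).
  have tE c : \val (insubd (exist _ a a_b : D) c) = if c != b then c else a.
    by rewrite val_insubd.
  split; last by left; rewrite card_sig cardC1; 
    have := max_card (pred1 b); rewrite card1; lia.
  split => //.
  - apply/funext => c; rewrite subst1 tE.
    by case: eqP => // ->.
  - by move=> x; exists (val x), [::]; rewrite /t valKd.
  - have -> : total_size (fun x : D => s (val x)) = \sum_(c | c != b) size (s c).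
      exact/esym/(big_sub [pred x | x != b] (fun c => size (s c))).
    rewrite /total_size [X in _ < X](bigD1 b)//=.
    have : 0 < size (s b) by have := sne b; case: (s b).
    by lia.
pose t c := if c == b then [:: a; b] else [:: c].
pose u c := if c == b then b0 :: w else s c.
have aNb : (a == b) = false by apply/eqP.
have une : nonerasing u by move=> c; rewrite /u; case: ifP.
have sE : s = (fun c => subst u (t c)).
  apply/funext => c; rewrite /t; case: eqP => [->|cb].
    by rewrite subst_cons subst1 /u aNb eqxx.
  by rewrite subst1 /u; case: eqP.
exists C, t, u; split.
  split => //.
  - by move=> c; rewrite /t; case: ifP.
  - by move=> x; exists x; rewrite /t; case: eqP => [->|]; 
      [exists [:: a]|exists [::]].
  - rewrite /total_size (bigD1 b)//= [X in _ < X](bigD1 b)//=.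
    have -> : \sum_(i : C | i != b) size (u i) = \sum_(i : C | i != b) size (s i).
      by apply: eq_bigr => i ib; rewrite /u (negbTE ib).
    rewrite /u eqxx sbE size_cat/=.
    have : 0 < size (s a) by have := sne a; case: (s a).
    by lia.
(* The witness is the end of the letter [a] of [r]. There [r'] enters the second letter of [t b],
   labelled [(b, 0)], while [r] starts a new letter, and no word [t c] begins with [b]. *)
right; split => // e; exists (n1 + (lift_height h s a)%:Z)%R; first by lia.
have hE : lift_height (lift_height h u) t = lift_height h s.
  by rewrite lift_height_comp -sE.
have := row_next_cut rowr ra.
case: (r _) => c o /= ->.
have ha : lift_height h s a = lift_height h u a.
  by rewrite /lift_height /u aNb.
have hu := lift_height_gt0 h_gt0 une.
have hb := hu b.
rewrite (row_forward rowr' rb'); last first.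
  have -> : lift_height h s b = lift_height h u a + lift_height h u b.
    rewrite -hE {1}/lift_height /t eqxx expand_cons size_cat size_map.
    by rewrite size_iota size_expand1.
  rewrite ha add0n -addn1 leq_add2l; exact: hb.
rewrite add0n ha /proj /= {2}/t eqxx.
have -> : lift_height h u a = size (expand (lift_height h u) [:: a]) + 0.
  by rewrite size_expand1 addn0.
rewrite (@nth_expand _ _ _ [:: a] b [::] 0)//.
rewrite /t; case: eqP => cb; rewrite (nth_expand_head hu) => -[].
- by move/eqP; rewrite aNb.
- exact: cb.
Qed.

(** Words with different last letters come from different letters of [C]. *)
Lemma card_last_letter (C D : finType) (t : C -> seq D) :
  (forall x, exists c w, t c = rcons w x) -> #|D| <= #|C|.
Proof.
move=> /choice[f fE]; apply: (@leq_card _ _ f) => x y fxy.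
have [w E] := fE x; have [w' E'] := fE y.
by move: E; rewrite fxy E' => /rcons_inj[].
Qed.

(** [elimination_step] is repeated at the first disagreement until the rows coincide from [n0] on;
    the decrease of [total_size] makes this stop. A step that keeps the number of letters leaves a
    disagreement, so it cannot be the last one: some step lowers the number. *)
Lemma right_elimination (C : finType) (s : C -> seq B) (r r' : int -> C * nat)
    (n0 : int) :
  nonerasing s -> row (lift_height h s) r -> row (lift_height h s) r' ->
  (r n0).2 = 0 -> (r' n0).2 = 0 ->
  (forall n, (n0 <= n)%R -> proj h s d (r n) = proj h s d (r' n)) ->
  exists (D : finType) (t : C -> seq D) (u : D -> seq B),
    [/\ s = (fun c => subst u (t c)), nonerasing t, nonerasing u &
        (forall x, exists c w, t c = rcons w x)] /\
    [/\ forall e n, (n0 <= n)%R ->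
          proj (lift_height h u) t e (r n) = proj (lift_height h u) t e (r' n) &
        (exists2 n, (n0 <= n)%R & r n <> r' n) -> #|D| < #|C|].
Proof.
have [N] := ubnP (total_size s); elim: N => // N IH in C s r r' *.
rewrite ltnS => sN sne rowr rowr' r0 r'0 agree.
have [eqrr'|] := pselect (forall n, (n0 <= n)%R -> r n = r' n).
  exists C, (fun c => [:: c]), s; split.
    split => //; first by apply/funext => c; rewrite subst1.
    by move=> x; exists x, [::].
  by split=> [e n n0n|[n n0n]]; rewrite eqrr'.
move=> /existsNP[n /not_implyP[n0n rn]].
have exk : exists k : nat, `[< r (n0 + k%:Z)%R <> r' (n0 + k%:Z)%R >].
  exists `|n - n0|%N; apply/asboolP.
  by have -> : (n0 + `|n - n0|%N%:Z = n)%R by lia.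
case: (ex_minnP exk) => k /asboolP rk kmin.
set n1 := (n0 + k%:Z)%R in rk.
(* Inside a letter a row is determined by its previous position, so the first disagreement is a cut
   of both rows. *)
have [r1 r'1] : (r n1).2 = 0 /\ (r' n1).2 = 0.
  move: kmin rk; rewrite /n1; clear n1 exk; case: k => [|k] kmin rk.
    by rewrite addr0.
  have rk' : r (n0 + k%:Z)%R = r' (n0 + k%:Z)%R.
    by apply: contrapT => /asboolP/kmin; rewrite ltnn.
  move: rk; have -> : (n0 + k.+1%:Z = n0 + k%:Z + 1)%R by lia.
  have [_] := rowr (n0 + k%:Z)%R; have [_] := rowr' (n0 + k%:Z)%R.
  by rewrite -rk'; case: ifP => [_ -> ->|_ -> ->].
have [D [t [u [[sE tne une last_t lt_u] card_D]]]] : exists (D : finType)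
   (t : C -> seq D) (u : D -> seq B),
    [/\ s = (fun c => subst u (t c)), nonerasing t, nonerasing u,
        (forall x, exists c w, t c = rcons w x) & total_size u < total_size s] /\
    (#|D| < #|C| \/ #|D| = #|C| /\ forall e, exists2 n, (n1 <= n)%R &
       proj (lift_height h u) t e (r n) <> proj (lift_height h u) t e (r' n)).
  case E : (r n1) r1 rk => [a o] /= o0; case E' : (r' n1) r'1 => [b o'] /= o'0.
  move: o0 o'0 E E' => -> -> E E' neq.
  have {neq} ab : a <> b by move=> ab; apply: neq; rewrite ab.
  have n01 n' : (n1 <= n')%R -> (n0 <= n')%R by rewrite /n1; lia.
  case: (leqP (size (expand h (s a))) (size (expand h (s b)))) => [le|/ltnW le].
    by apply: (elimination_step sne rowr rowr' E E') => // n' /n01; exact: agree.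
  have agree' n' : (n1 <= n')%R -> proj h s d (r' n') = proj h s d (r n').
    by move=> /n01 /agree.
  have [D [t [u [P card_D]]]] :=
    elimination_step sne rowr' rowr E' E (nesym ab) le agree'.
  - exists D, t, u; split => //; case: card_D => [|[DC P']]; [by left|right].
    by split => // e; have [n2 ? /nesym ?] := P' e; exists n2.
subst s.
have e1 : D * nat by case: (t (r n0).1) (tne (r n0).1) => // x _ _; exact: (x, 0).
pose q := fun n => proj (lift_height h u) t e1 (r n).
pose q' := fun n => proj (lift_height h u) t e1 (r' n).
have hu := lift_height_gt0 h_gt0 une.
have rowq : row (lift_height h u) q.
  by apply: row_proj => //; rewrite lift_height_comp.
have rowq' : row (lift_height h u) q'.
  by apply: row_proj => //; rewrite lift_height_comp.
have lt_r p m : row (lift_height h (fun c => subst u (t c))) p ->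
    (p m).2 < lift_height (lift_height h u) t (p m).1.
  by rewrite lift_height_comp => /row_lt.
have [|D2 [t2 [u2 [[uE t2ne u2ne last_t2] [agree2 card2]]]]] :=
  IH D u q q' (leq_trans lt_u sN) une rowq rowq' (proj_cut e1 hu tne r0)
    (proj_cut e1 hu tne r'0).
  move=> n' n0n'; rewrite -!proj_comp; [exact: agree|exact: lt_r..].
subst u.
exists D2, (fun c => subst t2 (t c)), u2; split.
  split => //.
  - by apply/funext => c; rewrite subst_comp.
  - by move=> c; apply: subst_neq_nil.
  - move=> x; have [x' [w E]] := last_t2 x; have [c [w' E']] := last_t x'.
    exists c, (subst t2 w' ++ w).
    by rewrite E' -cats1 subst_cat subst1 E rcons_cat.
split.
  have hE : lift_height h (fun c => subst (fun x => subst u2 (t2 x)) (t c)) =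
      lift_height (lift_height (lift_height h u2) t2) t.
    by rewrite -lift_height_comp -(lift_height_comp h u2 t2).
  move=> e n' n0n'; rewrite (proj_comp _ e1) -?hE ?row_lt//.
  rewrite (proj_comp _ e1) -?hE ?row_lt// lift_height_comp.
  exact: agree2.
move=> _; have le2 := card_last_letter last_t2.
case: card_D => [|[<- /(_ e1)[m n1m qq']]]; first exact: leq_ltn_trans.
by apply: card2; exists m => //; move: n1m; rewrite /n1; lia.
Qed.

End Elimination.

Section Reversal.
Variables (B : Type) (h : B -> nat).

Definition flip (x : B * nat) := (x.1, h x.1 - x.2.+1).

(** The position [n0 - 1], the last one before the cut [n0], goes to 0, so that the left of the cut
    becomes the half-line from 0 on. *)
Definition rev_row (r : int -> B * nat) (n0 n : int) := flip (r (n0 - 1 - n)%R).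

Lemma flipK x : x.2 < h x.1 -> flip (flip x) = x.
Proof. by case: x => b i /= ib; congr pair; rewrite /=; lia. Qed.

Lemma row_rev r n0 : row h r -> row h (rev_row r n0).
Proof.
move=> rowr n; rewrite /step /rev_row.
have -> : (n0 - 1 - (n + 1) = (n0 - 1 - n) - 1)%R by lia.
set m := (n0 - 1 - n)%R.
have lt1 := row_lt rowr m.
case E : (r m) lt1 => [b [|i]] /= lt1; split; try lia.
  rewrite ifF; last by lia.
  by have := row_back_cut rowr (congr1 snd E); lia.
rewrite ifT; last by lia.
by rewrite (row_back rowr E) /flip/=; congr pair; lia.
Qed.

Lemma expand_rev w : expand h (rev w) = rev (map flip (expand h w)).
Proof.
have expand1 b : expand h [:: b] = rev (map flip (expand h [:: b])).
  rewrite expand_cons cats0.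
  apply: (@eq_from_nth _ (b, 0)); first by rewrite size_rev !size_map.
  move=> i; rewrite size_map size_iota => ib.
  rewrite nth_rev ?size_map ?size_iota// -map_comp.
  rewrite !(nth_map 0) ?size_iota ?nth_iota//; try lia.
  by rewrite /= /flip /=; congr pair; lia.
elim: w => // b w IH; rewrite -cat1s rev_cat !expand_cat map_cat rev_cat -IH.
by rewrite -expand1.
Qed.

Lemma lift_height_rev C (s : C -> seq B) :
  lift_height h (fun c => rev (s c)) = lift_height h s.
Proof.
by apply/funext => c; rewrite /lift_height expand_rev size_rev size_map.
Qed.

End Reversal.

Lemma proj_flip (B C : Type) (h : B -> nat) (s : C -> seq B) d e x :
  x.2 < lift_height h s x.1 ->
  proj h (fun c => rev (s c)) e (flip (lift_height h s) x) = flip h (proj h s d x).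
Proof.
case: x => c o /= oc; rewrite /proj /= expand_rev nth_rev; last first.
  by rewrite size_map -/(lift_height h s c); lia.
rewrite size_map (nth_map d); first by congr (flip _ (nth _ _ _)); 
  rewrite -/(lift_height h s c); lia.
by rewrite -/(lift_height h s c); lia.
Qed.

Lemma subst_rev (B C : Type) (s : C -> seq B) w :
  rev (subst s w) = subst (fun c => rev (s c)) (rev w).
Proof.
elim: w => // c w IH.
by rewrite subst_cons rev_cat IH rev_cons -cats1 subst_cat subst1.
Qed.

Lemma nonerasing_rev (B C : Type) (s : C -> seq B) :
  nonerasing s -> nonerasing (fun c => rev (s c)).
Proof. by move=> sne c /(congr1 size); rewrite size_rev => /size0nil/sne. Qed.

(** This is right elimination for the mirror images of the rows and of the words of [s]. A cut at
    [n0] becomes a cut at 0, because the position before it ends a letter. *)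
Lemma left_elimination (B : Type) (h : B -> nat) (d : B * nat) (C : finType)
    (s : C -> seq B) (r r' : int -> C * nat) (n0 : int) :
  (forall b, 0 < h b) ->
  nonerasing s -> row (lift_height h s) r -> row (lift_height h s) r' ->
  (r n0).2 = 0 -> (r' n0).2 = 0 ->
  (forall n, (n < n0)%R -> proj h s d (r n) = proj h s d (r' n)) ->
  (exists2 n, (n < n0)%R & r n <> r' n) ->
  exists (D : finType) (t : C -> seq D) (u : D -> seq B),
    [/\ s = (fun c => subst u (t c)), nonerasing t, nonerasing u & #|D| < #|C|].
Proof.
move=> h_gt0 sne rowr rowr' r0 r'0 agree [n n0n rn].
set H := lift_height h s.
have cut0 p : row H p -> (p n0).2 = 0 -> (rev_row H p n0 0%R).2 = 0.
  move=> rowp /(row_back_cut rowp) E.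
  by rewrite /rev_row subr0 /flip /= E subnn.
have revr p : row H p -> row (lift_height h (fun c => rev (s c))) (rev_row H p n0).
  by rewrite lift_height_rev; exact: row_rev.
have agree' m : (0 <= m)%R -> proj h (fun c => rev (s c)) d (rev_row H r n0 m) =
    proj h (fun c => rev (s c)) d (rev_row H r' n0 m).
  by move=> m0; rewrite !(proj_flip d) ?row_lt// agree//; lia.
have [D [t [u [[sE tne une _] [_ card_D]]]]] :=
  right_elimination h_gt0 (nonerasing_rev sne) (revr _ rowr) (revr _ rowr')
    (cut0 _ rowr r0) (cut0 _ rowr' r'0) agree'.
exists D, (fun c => rev (t c)), (fun x => rev (u x)); split.
- apply/funext => c; rewrite -subst_rev.
  by have /(congr1 (fun f => rev (f c))) := sE; rewrite revK.
- exact: nonerasing_rev.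
- exact: nonerasing_rev.
- apply: card_D; exists (n0 - 1 - n)%R; first by lia.
  rewrite /rev_row; have -> : (n0 - 1 - (n0 - 1 - n) = n)%R by lia.
  move=> /(congr1 (flip H)); rewrite !flipK ?row_lt//.
Qed.

(** * Recognizability of elementary substitutions *)

(** Elementary morphisms in the sense of Ehrenfeucht and Rozenberg, with nonerasing factors. *)
Definition elementary (B : Type) (C : finType) (s : C -> seq B) :=
  forall (D : finType) (t : C -> seq D) (u : D -> seq B),
    s = (fun c => subst u (t c)) -> nonerasing t -> nonerasing u -> #|C| <= #|D|.

(** A value repeats within [#|S|.+1] positions, and determinism carries the repetition to the left.
    The gap depends on the place but is at most [#|S|], so it divides the factorial. *)
Lemma eventually_periodic_backward (S : finType) (q : int -> S) :
  (forall m n, q m = q n -> q (m - 1)%R = q (n - 1)%R) ->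
  exists2 p : nat, 0 < p & forall n, q (n + p%:Z)%R = q n.
Proof.
move=> qP; exists (#|{: S}| `!); first exact: fact_gt0.
move=> n; set p := #|{: S}| `!.
(* The window starts at [n + p], since the repetition spreads only to the left and has to reach
   [n]. *)
have /injectivePn[i [j ij qij]] :
    ~~ injectiveb (fun i : 'I_(#|S|.+1) => q (n + p%:Z + i%:Z)%R).
  by apply/negP => /injectiveP/leq_card; rewrite card_ord ltnn.
wlog ltij : i j ij qij / i < j.
  move=> wl; have := ij; rewrite -val_eqE /= neq_ltn => /orP[|] lt.
    exact: wl qij lt.
  by apply: (wl j i) => //; rewrite eq_sym.
pose g := j - i.
have qg k : q (n + p%:Z + i%:Z - k%:Z)%R = q (n + p%:Z + i%:Z - k%:Z + g%:Z)%R.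
  elim: k => [|k /qP IH].
    by rewrite subr0 qij /g; congr q; lia.
  have -> : (n + p%:Z + i%:Z - k.+1%:Z = n + p%:Z + i%:Z - k%:Z - 1)%R by lia.
  by rewrite IH; congr q; lia.
have gS : g <= #|S| by rewrite /g; have := ltn_ord j; lia.
have /dvdnP[t pE] : g %| p by apply: dvdn_fact; rewrite /g; lia.
have qt k : k <= t -> q n = q (n + (k * g)%N%:Z)%R.
  elim: k => [|k IH] kt; first by rewrite mul0n addr0.
  rewrite IH; last by lia.
  have le : k * g <= p by rewrite pE leq_mul2r; lia.
  have := qg (p - k * g + i).
  have -> : (n + p%:Z + i%:Z - (p - k * g + i)%N%:Z = n + (k * g)%N%:Z)%R by lia.
  by move=> ->; congr q; rewrite mulSn; lia.
by rewrite (qt t)// -pE.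
Qed.

(** The pair of rows is deterministic backwards. Where one row has a cut, the other is inside a
    letter and so shows the previous projected letter; this is the last letter of the word that ends
    at the cut, and it determines that word. *)
Lemma distinct_last_periodic (B : Type) (h : B -> nat) (d : B * nat)
    (C : finType) (s : C -> seq B) (r r' : int -> C * nat) :
  (forall b, 0 < h b) -> nonerasing s ->
  (forall c c' w w' x, s c = rcons w x -> s c' = rcons w' x -> c = c') ->
  row (lift_height h s) r -> row (lift_height h s) r' ->
  (forall n, proj h s d (r n) = proj h s d (r' n)) ->
  (forall n, (r n).2 = 0 -> (r' n).2 = 0 -> False) ->
  exists2 p : nat, 0 < p & forall n, r (n + p%:Z)%R = r n.
Proof.
move=> h_gt0 sne last_inj rowr rowr' agree nocut.
set H := lift_height h s.
pose M := \max_c H c.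
have lt_M p : row H p -> forall n, (p n).2 < M.+1.
  by move=> rowp n; rewrite ltnS ltnW// (leq_trans (row_lt rowp n))// leq_bigmax.
(* Offsets stay below [M.+1], so [inord] loses nothing and [q] records both rows in a finite
   type. *)
pose q n := ((r n).1, inord (r n).2 : 'I_M.+1, ((r' n).1, inord (r' n).2 : 'I_M.+1)).
have qP m n : q m = q n <-> r m = r n /\ r' m = r' n.
  rewrite /q; split; last by move=> [-> ->].
  move: (lt_M _ rowr m) (lt_M _ rowr n) (lt_M _ rowr' m) (lt_M _ rowr' n).
  case: (r m) (r n) (r' m) (r' n) => [c o] [c1 o1] [c2 o2] [c3 o3] /= ? ? ? ?.
  by move=> [-> /(congr1 val) /=] + -> /(congr1 val) /=; rewrite !inordK// => -> ->.
have last_proj p n : row H p -> (p n).2 = 0 ->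
    exists w x, s (p (n - 1)%R).1 = rcons w x /\ (proj h s d (p (n - 1)%R)).1 = x.
  move=> rowp /(row_back_cut rowp).
  case: (p _) => c o /= oE.
  case/lastP E : (s c) => [|w x]; first by have := sne c; rewrite E.
  by exists w, x; split => //; exact: proj_last E oE.
have cut_case p p' : row H p -> row H p' ->
   (forall n, proj h s d (p n) = proj h s d (p' n)) ->
   (forall n, (p n).2 = 0 -> (p' n).2 = 0 -> False) ->
   forall m n, p m = p n -> p' m = p' n -> p (m - 1)%R = p (n - 1)%R.
  move=> rowp rowp' ag nc m n pmn p'mn.
  case E : (p m) => [c [|o]]; last first.
    by rewrite (row_back rowp E) (row_back rowp (etrans (esym pmn) E)).
  case E' : (p' m) => [c' [|o']]; first by case: (nc m); rewrite ?E ?E'.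
  have pm0 : (p m).2 = 0 by rewrite E.
  have pn0 : (p n).2 = 0 by rewrite -pmn E.
  have [w [x [sE xE]]] := last_proj p m rowp pm0.
  have [w' [x' [sE' xE']]] := last_proj p n rowp pn0.
  (* At [m] and at [n] the row [p'] is inside the same letter at the same offset, so the projected
     letters just before agree. *)
  have xx' : x = x'.
    rewrite -xE -xE' !ag (row_back rowp' E').
    by rewrite (row_back rowp' (etrans (esym p'mn) E')).
  have := row_back_cut rowp pm0; have := row_back_cut rowp pn0.
  rewrite -xx' in sE'; have := last_inj _ _ _ _ _ sE sE'.
  case: (p _) => e i /=; case: (p _) => e' i' /= -> + [].
  by move=> <- [->].
have [m n|p p0 pP] := @eventually_periodic_backward _ q.
  move/qP => [rmn r'mn]; apply/qP; split.
    exact: (cut_case r r').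
  by apply: (cut_case r' r) => // k r'k rk; apply: (nocut k).
by exists p => // n; have /qP[] := pP n.
Qed.

(** A disagreement on either side of the common cut would let an elimination factor [s] through
    fewer letters. *)
Lemma elementary_common_cut (B : Type) (h : B -> nat) (d : B * nat)
    (C : finType) (s : C -> seq B) (r r' : int -> C * nat) (n0 : int) :
  (forall b, 0 < h b) -> nonerasing s -> elementary s ->
  row (lift_height h s) r -> row (lift_height h s) r' ->
  (forall n, proj h s d (r n) = proj h s d (r' n)) ->
  (r n0).2 = 0 -> (r' n0).2 = 0 -> forall n, r n = r' n.
Proof.
move=> h_gt0 sne el rowr rowr' agree r0 r'0 n; apply: contrapT => rn.
have [n0n|nn0] := leP n0 n.
  have [D [t [u [[sE tne une _] [_ lt]]]]] :=
    right_elimination h_gt0 sne rowr rowr' r0 r'0 (fun n _ => agree n).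
  have := el D t u sE tne une; rewrite leqNgt => /negP; apply; apply: lt.
  by exists n.
have [|D [t [u [sE tne une lt]]]] :=
  left_elimination h_gt0 sne rowr rowr' r0 r'0 (fun n _ => agree n).
  by exists n.
by have := el D t u sE tne une; rewrite leqNgt lt.
Qed.

Lemma surjective_card_injective (C D : finType) (f : C -> D) :
  (forall x, exists c, f c = x) -> #|C| <= #|D| -> injective f.
Proof.
move=> /choice[g gK] le.
have ginj : injective g := can_inj gK.
have [k kK gk] := inj_card_bij ginj le.
have fE : f =1 k by move=> c; rewrite -{1}(gk c) gK.
by move=> c c'; rewrite !fE => /(can_inj gk).
Qed.

(* Without a common cut, a cut of [r] splits a letter [c] of [r'] into two new
   letters.  Right elimination then brings the alphabet back to the size of [C],
   so nothing is left to eliminate on the left of the cut.  Elimination only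
   changes words on the left, hence the images of the letters of [C] keep distinct
   last letters, which makes the pair [(r, r')] deterministic backwards. *)
Theorem elementary_recognizable (B : Type) (h : B -> nat) (d : B * nat)
    (C : finType) (s : C -> seq B) (r r' : int -> C * nat) :
  (forall b, 0 < h b) -> nonerasing s -> elementary s ->
  row (lift_height h s) r -> row (lift_height h s) r' ->
  (forall n, proj h s d (r n) = proj h s d (r' n)) ->
  (forall p : nat, 0 < p ->
    exists n, proj h s d (r (n + p%:Z)%R) <> proj h s d (r n)) ->
  forall n, r n = r' n.
Proof.
move=> h_gt0 sne el rowr rowr' agree aper.
have [[n0 [r0 r'0]]|nocut] := pselect (exists n, (r n).2 = 0 /\ (r' n).2 = 0).
  exact: (elementary_common_cut h_gt0 sne el rowr rowr' agree r0 r'0).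
exfalso.
suff [p p0 pP] : exists2 p : nat, 0 < p & forall n, r (n + p%:Z)%R = r n.
  by have [n] := aper p p0; rewrite pP.
have [n0 r0] := row_cut rowr.
case r'E : (r' n0) => [c o].
have o_gt0 : 0 < o.
  by case: o r'E => // r'E; case: nocut; exists n0; rewrite r'E.
have oc : o < size (expand h (s c)) by have := row_lt rowr' n0; rewrite r'E.
have [w1 [b [w2 [i [sc ib oE]]]]] := expand_locate oc.
(* A cut of [r] projects to a cut of the lower row, so the offset [o] falls at the start of the
   letter [b] of [s c]. *)
have {ib} i0 : i = 0.
  have := proj_cut d h_gt0 sne r0.
  by rewrite agree r'E /proj /= sc oE nth_expand.
subst i; rewrite addn0 in oE.
have w1ne : w1 <> [::] by move=> w10; rewrite oE w10 in o_gt0.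
(* The letter [c] is split at the cut: [Some c] stands for its left part and [None] for its right
   part. In the new alphabet, of size [#|C|.+1], the two rows have a common cut at [n0]. *)
pose s' (x : option C) :=
  if x is Some e then if e == c then w1 else s e else b :: w2.
pose k (e : C) := if e == c then [:: Some c; None] else [:: Some e].
have kne : nonerasing k by move=> e; rewrite /k; case: ifP.
have s'ne : nonerasing s' by case=> [e|//] /=; case: ifP.
have sE : s = (fun e => subst s' (k e)).
  apply/funext => e; rewrite /k; case: eqP => [->|/eqP/negbTE ec].
    by rewrite subst_cons subst1 /= eqxx.
  by rewrite subst1 /= ec.
pose H := lift_height h s'.
have H_gt0 : forall x, 0 < H x := lift_height_gt0 h_gt0 s'ne.
have HE : lift_height H k = lift_height h s by rewrite lift_height_comp -sE.
pose e0 : option C * nat := (None, 0).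
pose R n := proj H k e0 (r n); pose R' n := proj H k e0 (r' n).
have rowR : row H R by apply: row_proj => //; rewrite HE.
have rowR' : row H R' by apply: row_proj => //; rewrite HE.
have projR p n : row (lift_height h s) p ->
    proj h s d (p n) = proj h s' d (proj H k e0 (p n)).
  by move=> rowp; rewrite {1}sE (proj_comp _ e0)// HE row_lt.
have agreeR n : proj h s' d (R n) = proj h s' d (R' n) by rewrite -!projR.
have R0 : (R n0).2 = 0 by apply: proj_cut.
have Hc : H (Some c) = o by rewrite /H /lift_height /= eqxx.
have R'n0 : R' n0 = (None, 0).
  have -> : R' n0 = nth e0 (expand H ([:: Some c] ++ [:: None]))
      (size (expand H [:: Some c]) + 0).
    by rewrite size_expand1 addn0 Hc /R' r'E /proj /= /k eqxx.
  by rewrite (@nth_expand _ _ _ [:: Some c]).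
have R'0 : (R' n0).2 = 0 by rewrite R'n0.
(* No word [k e] begins with [None]. This disagreement makes right elimination remove at least one
   letter, back to at most [#|C|]. *)
have Rn0 : R n0 <> R' n0.
  rewrite R'n0 /R; case: (r n0) r0 => a o' /= ->; rewrite /proj /= /k.
  by case: ifP => _; rewrite nth_expand_head.
have [D [t [u [[s'E tne une last_t] [agreeQ card_D]]]]] :=
  right_elimination h_gt0 s'ne rowR rowR' R0 R'0 (fun n _ => agreeR n).
have {}card_D : #|D| <= #|C|.
  by rewrite -ltnS; have := card_D; rewrite card_option; apply; exists n0.
pose tk e := subst t (k e).
have tkne : nonerasing tk by move=> e; apply: subst_neq_nil.
have sE' : s = (fun e => subst u (tk e)).
  by rewrite sE; apply/funext => e; rewrite s'E subst_comp.
have card_DC : #|C| <= #|D| by apply: el sE' tkne une.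
have x0 : D by case: (t None) (tne None) => // x _ _; exact: x.
pose q0 : D * nat := (x0, 0).
pose G := lift_height h u.
have G_gt0 : forall x, 0 < G x := lift_height_gt0 h_gt0 une.
have GE : lift_height G t = H by rewrite lift_height_comp -s'E.
pose Q n := proj G t q0 (R n); pose Q' n := proj G t q0 (R' n).
have rowQ : row G Q by apply: row_proj => //; rewrite GE.
have rowQ' : row G Q' by apply: row_proj => //; rewrite GE.
have agreeu n : proj h u d (Q n) = proj h u d (Q' n).
  by rewrite -!proj_comp -/G ?GE ?row_lt// -s'E.
have projQ p n : row (lift_height h s) p ->
    proj G tk q0 (p n) = proj G t q0 (proj H k e0 (p n)).
  by move=> rowp; rewrite (proj_comp _ e0) GE ?HE ?row_lt.
(* On the right the rows agree by elimination; on the left a disagreement would factor [s] through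
   fewer than [#|C|] letters. *)
have eqQ n : Q n = Q' n.
  have [n0n|nn0] := leP n0 n; first exact: agreeQ.
  apply: contrapT => Qn.
  have [|D2 [t2 [u2 [uE t2ne u2ne lt]]]] :=
    left_elimination h_gt0 une rowQ rowQ' (proj_cut q0 G_gt0 tne R0)
      (proj_cut q0 G_gt0 tne R'0) (fun n _ => agreeu n).
    by exists n.
  have : #|C| <= #|D2|.
    apply: (el D2 (fun e => subst t2 (tk e)) u2) => //.
      by rewrite sE'; apply/funext => e; rewrite uE subst_comp.
    by move=> e; apply: subst_neq_nil.
  by rewrite leqNgt (leq_trans lt).
pose L x := last x0 (t x).
have LE x : exists w, t x = rcons w (L x).
  by rewrite /L; case/lastP: (t x) (tne x) => // w y _; exists w; rewrite last_rcons.
pose g e := L (if e == c then None else Some e).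
have gE e : exists w, tk e = rcons w (g e).
  rewrite /tk /k /g; case: eqP => [_|_].
    have [w E] := LE None; exists (t (Some c) ++ w).
    by rewrite subst_cons subst1 E rcons_cat.
  by rewrite subst1.
(* The letter [L (Some c)] ends at [n0 - 1] in [Q'], hence also in [Q], where it is the last letter
   of [tk e] for the letter [e] of [r] that ends there. *)
have gL : exists e, g e = L (Some c).
  case rE : (r (n0 - 1)%R) => [e oe]; exists e.
  have := row_back_cut rowr r0; rewrite rE /= => oeE.
  have [w tkE] := gE e; have [w' tE] := LE (Some c).
  have tkH : lift_height G tk = lift_height h s.
    by rewrite lift_height_comp -sE'.
  have <- : (Q (n0 - 1)%R).1 = g e.
    rewrite /Q /R -projQ// rE.
    by apply: proj_last tkE _ => //; rewrite tkH.
  rewrite eqQ /Q' /R'.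
  case: o r'E oE Hc {oc} o_gt0 => // o r'E oE Hc _.
  rewrite (row_back rowr' r'E).
  have -> : proj H k e0 (c, o) = (Some c, o).
    rewrite /proj /= /k eqxx -(add0n o).
    by rewrite (@nth_expand _ _ _ [::] (Some c) [:: None])// Hc.
  by apply: proj_last tE _ => //; rewrite GE Hc.
(* Each letter of [D] is the last letter of some [t y], and [gL] covers the case [y = Some c], so
   [g] is onto an alphabet no smaller than [C]. *)
have ginj : injective g.
  apply: surjective_card_injective => // x.
  have [y [w ty]] := last_t x.
  have <- : L y = x by rewrite /L ty last_rcons.
  case: y {ty} => [e|]; last by exists c; rewrite /g eqxx.
  have [->|/negbTE ec] := eqVneq e c; first exact: gL.
  by exists e; rewrite /g ec.
have GtkE : lift_height G tk = lift_height h s by rewrite lift_height_comp -sE'.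
apply: (@distinct_last_periodic D G q0 C tk r r') => //; rewrite ?GtkE//.
- move=> e e' w w' x E E'; apply: ginj.
  have [v] := gE e; rewrite E => /rcons_inj[_ <-].
  by have [v'] := gE e'; rewrite E' => /rcons_inj[_ <-].
- by move=> n; rewrite !projQ//; exact: eqQ.
- by move=> n rn r'n; apply: nocut; exists n.
Qed.

(** * Codings by towers *)

Section Iterz.
Variables (X : topologicalType) (f : homeo X X).

Lemma iterzS n x : iterz f (n + 1)%R x = f (iterz f n x).
Proof.
case: n => [k|[|k]].
- by rewrite -PoszD addn1.
- by have -> : (Negz 0 + 1 = Posz 0)%R by []; rewrite /= homeo_invK.
- have -> : (Negz k.+1 + 1 = Negz k)%R by rewrite !NegzE; lia.
  by rewrite /= homeo_invK.
Qed.

Lemma iterzB1 n x : iterz f (n - 1)%R x = homeo_inv f (iterz f n x).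
Proof. by rewrite -{2}(subrK 1%R n) iterzS homeo_funK. Qed.

Lemma iterzD m n x : iterz f (m + n)%R x = iterz f m (iterz f n x).
Proof.
elim/int_rect: m => [|m IH|m IH]; first by rewrite add0r.
- have -> : (m.+1%:Z + n = m%:Z + n + 1)%R by lia.
  by rewrite iterzS IH -iterzS; congr iterz; lia.
- have -> : (- m.+1%:Z + n = - m%:Z + n - 1)%R by lia.
  by rewrite iterzB1 IH -iterzB1; congr iterz; lia.
Qed.

Lemma iterzK n x : iterz f n (iterz f (- n)%R x) = x.
Proof. by rewrite -iterzD subrr. Qed.

End Iterz.

(* [coding n x] is the vertex of [x] at level [n] together with the height of
   [x] in the tower of that vertex. *)
Record tower_coding (X : topologicalType) (f : homeo X X) := TowerCoding {
  letter : nat -> finType;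
  height : forall n, letter n -> nat;
  word : forall n, letter n.+1 -> seq (letter n);
  coding : forall n, X -> letter n * nat;
  height_gt0 : forall n v, 0 < @height n v;
  word_nonerasing : forall n, nonerasing (@word n);
  height_word : forall n, @height n.+1 = lift_height (@height n) (@word n);
  coding_step : forall n x, step (@height n) (coding n x) (coding n (f x));
  coding_proj : forall n d x,
    proj (@height n) (@word n) d (coding n.+1 x) = coding n x;
  coding_locally_constant : forall n x, \forall y \near x, coding n y = coding n x;
  coding_inj : forall x y, (forall n, coding n x = coding n y) -> x = y }.

Section Coding.
Variables (X : topologicalType) (f : homeo X X) (T : tower_coding f).

Local Notation V := (@letter X f T).
Local Notation h := (@height X f T).
Local Notation pi := (@coding X f T).

Definition same_row n x y := forall k, pi n (iterz f k x) = pi n (iterz f k y).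

Definition row_period n (p : nat) x :=
  forall k, pi n (iterz f (k + p%:Z)%R x) = pi n (iterz f k x).

Definition bounded_rank K := forall n, exists2 m, n <= m & #|V m| <= K.

Lemma coding_le n m x y : n <= m -> pi m x = pi m y -> pi n x = pi n y.
Proof.
move/subnK <-; elim: (m - n) => // k IH E; apply: IH.
rewrite -(coding_proj (pi (k + n) x) x) -(coding_proj (pi (k + n) x) y).
by congr proj.
Qed.

Lemma same_row_le n m x y : n <= m -> same_row m x y -> same_row n x y.
Proof. by move=> nm E k; exact: coding_le (E k). Qed.

Lemma row_step (B : Type) (H : B -> nat) (q : X -> B * nat) :
  (forall x, step H (q x) (q (f x))) -> forall x, row H (fun k => q (iterz f k x)).
Proof. by move=> stepq x k; rewrite iterzS. Qed.

Lemma row_coding n x : row (@h n) (fun k => pi n (iterz f k x)).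
Proof. by apply: row_step; exact: coding_step. Qed.

Lemma word_between n m : n <= m -> exists s : V m -> seq (V n),
  [/\ nonerasing s, @h m = lift_height (@h n) s &
      forall d x, proj (@h n) s d (pi m x) = pi n x].
Proof.
move/subnK <-; elim: (m - n) => [|k [s [sne hE sP]]].
  exists (fun v => [:: v]); split => //.
    by apply/funext => v; rewrite /lift_height size_expand1.
  move=> d x; have := coding_step T n x => -[+ _] /=.
  change (0 + n) with n.
  case: (pi n x) => v o /= ov; rewrite /proj -[(v, o).2]add0n.
  exact: (@nth_expand _ _ _ [::]).
exists (fun v => subst s (word v)); split.
- by move=> v; apply: subst_neq_nil => //; exact: word_nonerasing.
- by rewrite -lift_height_comp -hE height_word.
- move=> d x; rewrite (proj_comp _ (pi (k + n) x)).
    by rewrite -hE coding_proj.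
  by rewrite -hE -height_word; have [] := coding_step T (k + n).+1 x.
Qed.

(** A reading of the rows of level [n] through an alphabet that need not be a level of the diagram;
    it keeps what the elimination of letters preserves. *)
Definition cover n j := exists (D : finType) (u : D -> seq (V n)) (q : X -> D * nat),
  [/\ #|D| <= j, nonerasing u,
      forall x, step (lift_height (@h n) u) (q x) (q (f x)) &
      forall d x, proj (@h n) u d (q x) = pi n x].

Lemma cover_level n m j : n <= m -> cover m j -> cover n j.
Proof.
move=> nm [D [u [q [Dj une stepq projq]]]].
have [s [sne hE sP]] := word_between nm.
exists D, (fun x => subst s (u x)), q; split => //.
- by move=> x; apply: subst_neq_nil.
- by rewrite -lift_height_comp -hE.
- move=> d x; rewrite (proj_comp _ (pi m x)); first by rewrite -hE projq.
  by rewrite -hE; have [] := stepq x.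
Qed.

Lemma cover_bounded K n : bounded_rank K -> cover n K.
Proof.
move=> /(_ n)[m nm mK]; apply: (cover_level nm).
exists (V m), (fun v => [:: v]), (pi m).
have hE : lift_height (@h m) (fun v : V m => [:: v]) = @h m.
  by apply/funext => v; rewrite /lift_height size_expand1.
split=> // [x|d x]; first by rewrite hE; exact: coding_step.
have := coding_step T m x => -[+ _].
case: (pi m x) => v o /= ov; rewrite /proj -[(v, o).2]add0n.
exact: (@nth_expand _ _ _ [::]).
Qed.

(* From some level on, the rank of the covers is constant, so that a smallest
   cover of any higher level is elementary over the lower one. *)
Lemma same_row_periodic K : bounded_rank K ->
  exists N, forall n, N <= n -> forall x y, same_row n x y -> x <> y ->
    exists2 p, 0 < p & row_period n p x.
Proof.
move=> boundK.
have exr : exists r, `[< forall n, cover n r >].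
  by exists K; apply/asboolP => n; exact: cover_bounded.
case: (ex_minnP exr) => r /asboolP coverr rmin.
(* By minimality of [r], some level [N] has no cover by fewer than [r] letters; by [cover_level],
   neither has any higher level. *)
have [N NP] : exists N, forall j, j < r -> ~ cover N j.
  case: r coverr rmin => [|r] _ rmin; first by exists 0.
  have /existsNP[N nc] : ~ (forall n, cover n r).
    by move=> /asboolP/rmin; rewrite ltnn.
  exists N => j jr [D [u [q [Dj ? ? ?]]]]; apply: nc.
  by exists D, u, q; split => //; exact: leq_trans Dj jr.
exists N => n Nn x y xy_n neq; apply: contrapT => aper.
apply: neq; apply: (coding_inj (t := T)) => m.
wlog nm : m / n <= m.
  move=> wl; have [|/ltnW mn] := leqP n m; first exact: wl.
  exact: (coding_le mn (wl n (leqnn n))).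
have [D [u [q [Dr une stepq projq]]]] := coverr m.
have [s [sne hE sP]] := word_between nm.
suff E : q (iterz f 0%R x) = q (iterz f 0%R y).
  by rewrite -(projq (pi m x) x) -(projq (pi m x) y); congr proj.
have rowq z : row (lift_height (@h n) (fun a => subst s (u a)))
    (fun k => q (iterz f k z)).
  by rewrite -lift_height_comp -hE; exact: row_step.
have projsq d z : proj (@h n) (fun a => subst s (u a)) d (q z) = pi n z.
  rewrite (proj_comp _ (pi m x)); first by rewrite -hE projq.
  by rewrite -hE; have [] := stepq z.
apply: (elementary_recognizable (d := pi n x) (@height_gt0 _ _ T n) _ _
  (rowq x) (rowq y)).
- by move=> a; apply: subst_neq_nil.
(* A factorization through fewer letters would give a smaller cover of level [n], hence one of level
   [N]. *)
- move=> D2 t u2 sE tne u2ne; rewrite leqNgt; apply/negP => lt.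
  have e : D2 * nat.
    by case: (t (q x).1) (tne (q x).1) => // a _ _; exact: (a, 0).
  apply: (NP #|D2| (leq_trans lt Dr)); apply: (cover_level Nn).
  exists D2, u2, (fun z => proj (lift_height (@h n) u2) t e (q z)).
  have stepq' z : step (lift_height (lift_height (@h n) u2) t) (q z) (q (f z)).
    by rewrite lift_height_comp -sE -lift_height_comp -hE.
  split => //.
  + have H_gt0 := lift_height_gt0 (@height_gt0 _ _ T n) u2ne.
    by move=> z; apply: proj_step.
  + move=> d z; rewrite -proj_comp; last by have [] := stepq' z.
    by rewrite -sE.
- by move=> k; rewrite !projsq; exact: xy_n.
- move=> p p0; apply: contrapT => /forallNP per; apply: aper; exists p => // k.
  by have /contrapT := per k; rewrite !projsq.
Qed.

End Coding.

(** * Minimal sets and periodic points *)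

Section ClosedInvariant.
Local Open Scope classical_set_scope.
Variables (X : topologicalType).
Hypothesis cptX : compact [set: X].

Lemma compact_chain (F : set (set X)) : F !=set0 ->
  (forall M, F M -> closed M) -> (forall M, F M -> M !=set0) ->
  total_on F subset -> exists x, forall M, F M -> M x.
Proof.
move=> F0 Fcl Fne Ftot.
have filF : ProperFilter (filter_from F id).
  apply: filter_from_proper => //.
  apply: filter_from_filter => // M N FM FN.
  by have [MN|NM] := Ftot _ _ FM FN; [exists M|exists N] => // x ?; split; auto.
have [|x [_ clx]] := cptX filF.
  by case: F0 => M FM; exists M.
exists x => M FM; apply: (Fcl _ FM) => U xU.
by apply: clx => //; exists M.
Qed.

Lemma compact_nested (A : nat -> set X) : (forall n, closed (A n)) ->
  (forall n, A n !=set0) -> (forall n, A n.+1 `<=` A n) ->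
  exists x, forall n, A n x.
Proof.
move=> Acl Ane Adec.
have Ale n m : n <= m -> A m `<=` A n.
  move/subnK <-; elim: (m - n) => // k IH.
  exact: subset_trans (Adec _) IH.
have [||||x xA] := @compact_chain (range A).
- by exists (A 0), 0.
- by move=> _ [n _ <-].
- by move=> _ [n _ <-].
- move=> _ _ [n _ <-] [m _ <-].
  by have [/Ale|/ltnW/Ale] := leqP n m; [right|left].
by exists x => n; apply: xA; exists n.
Qed.

Variable f : homeo X X.

Lemma closed_invariantP (M : set X) : closed_invariant f M <->
  [/\ M !=set0, closed M & forall x, M (f x) <-> M x].
Proof.
split=> [[M0 Mcl fM]|[M0 Mcl fM]]; split => //.
- move=> x; split; last by move=> Mx; rewrite -fM; exists x.
  by rewrite -{1}fM => -[y My /(can_inj (homeo_funK f)) <-].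
- apply/seteqP; split=> [_ [x Mx <-]|x Mx]; first exact/fM.
  exists (homeo_inv f x); last exact: homeo_invK.
  by apply/fM; rewrite homeo_invK.
Qed.

Lemma closed_invariant_iterz (M : set X) k x :
  closed_invariant f M -> M (iterz f k x) <-> M x.
Proof.
move=> /closed_invariantP[_ _ fM]; elim/int_rect: k => [//|k IH|k IH].
- have -> : (k.+1%:Z = k%:Z + 1)%R by lia.
  by rewrite iterzS; exact: iff_trans (fM _) IH.
- have -> : (- k.+1%:Z = - k%:Z - 1)%R by lia.
  apply: iff_trans IH; apply: iff_trans (iff_sym (fM _)) _.
  by rewrite iterzB1 homeo_invK.
Qed.

(** Zorn's lemma for reverse inclusion: a nonempty chain is bounded by its intersection, which is
    nonempty by compactness. *)
Lemma closed_invariant_minimal (A : set X) : closed_invariant f A ->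
  exists2 M, minimal_set f M & M `<=` A.
Proof.
move=> ciA.
pose P (M : set X) := closed_invariant f M /\ M `<=` A.
pose T := {M | P M}.
pose R (M N : T) : bool := `[< sval N `<=` sval M >].
have t0 : T by exists A; split.
have [|||t tmax] := @ZL_preorder T t0 R.
- by move=> t; apply/asboolP.
- by move=> r s t /asboolP rs /asboolP st; apply/asboolP; exact: subset_trans rs.
- move=> S Stot; have [S0|S0] := pselect (S !=set0); last first.
    by exists t0 => s Ss; case: S0; exists s.
  have [x xS] : exists x, forall M, [set sval s | s in S] M -> M x.
    apply: compact_chain.
    + by case: S0 => s Ss; exists (sval s), s.
    + by move=> _ [s Ss <-]; have [[]] := svalP s.
    + by move=> _ [s Ss <-]; have [[]] := svalP s.
    + move=> _ _ [s Ss <-] [u Su <-].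
      by have [/asboolP|/asboolP] := Stot _ _ Ss Su; [right|left].
  have ciN : closed_invariant f (\bigcap_(s in S) sval s) /\
      \bigcap_(s in S) sval s `<=` A.
    split; last first.
      case: S0 => s Ss y /(_ s Ss); have [_] := svalP s; exact.
    apply/closed_invariantP; split.
    + by exists x => s Ss; apply: xS; exists s.
    + by apply: closed_bigI => s _; have [[]] := svalP s.
    + move=> y; split=> yS s Ss; have [/closed_invariantP[_ _ fs] _] := svalP s.
        by apply/fs; exact: yS.
      by apply/fs; exact: yS.
  by exists (exist P _ ciN) => s Ss; apply/asboolP => y; exact.
have [cit tA] := svalP t; exists (sval t) => //; split => // N ciN Nt.
apply/seteqP; split => //.
have ciNA : closed_invariant f N /\ N `<=` A by split=> //; exact: subset_trans tA.
by have /asboolP := tmax (exist P N ciNA) (asboolT Nt).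
Qed.

Lemma minimal_sets_disjoint (M N : set X) x :
  minimal_set f M -> minimal_set f N -> M x -> N x -> M = N.
Proof.
move=> [ciM minM] [ciN minN] Mx Nx.
have ci : closed_invariant f (M `&` N).
  have /closed_invariantP[_ clM fM] := ciM.
  have /closed_invariantP[_ clN fN] := ciN.
  apply/closed_invariantP; split; [by exists x|exact: closedI|].
  by move=> y; split=> -[/fM ? /fN ?].
by rewrite -(minM _ ci (@subIsetl _ _ _)) (minN _ ci (@subIsetr _ _ _)).
Qed.

End ClosedInvariant.

Lemma continuous_iterz (X : topologicalType) (f : homeo X X) k :
  continuous (iterz f k).
Proof.
have it (g : X -> X) : continuous g -> forall n, continuous (iter n g).
  move=> cg; elim=> [x|n IH x]; first exact: cvg_id.
  exact: continuous_comp (IH x) (cg _).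
case: k => n; first exact/it/homeo_fun_continuous.
change (continuous (iter n.+1 (homeo_inv f))).
exact/it/homeo_inv_continuous.
Qed.

Section Coding.
Local Open Scope classical_set_scope.
Variables (X : topologicalType) (f : homeo X X) (T : tower_coding f).
Hypothesis cptX : compact [set: X].

Local Notation V := (@letter X f T).
Local Notation pi := (@coding X f T).
Local Notation row_period := (@row_period X f T).
Local Notation same_row := (@same_row X f T).

Lemma coding_iterz_locally_constant n k x :
  \forall y \near x, pi n (iterz f k y) = pi n (iterz f k x).
Proof.
exact: (continuous_iterz (coding_locally_constant T n (iterz f k x))).
Qed.

Lemma closed_coding n k (P : V n * nat -> Prop) :
  closed [set x | P (pi n (iterz f k x))].
Proof.
move=> x clx; have [y [/= Py <-//]] := clx _ (coding_iterz_locally_constant n k x).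
Qed.

Lemma closed_same_row n x : closed [set y | same_row n y x].
Proof.
have -> : [set y | same_row n y x] =
    \bigcap_(k in [set: int]) [set y | pi n (iterz f k y) = pi n (iterz f k x)].
  by apply/seteqP; split=> y /= E k; [move=> _|]; exact: E.
apply: closed_bigI => k _.
exact: (@closed_coding n k (fun v => v = pi n (iterz f k x))).
Qed.

Lemma same_row_iterz n k x y :
  same_row n x y -> same_row n (iterz f k x) (iterz f k y).
Proof. by move=> E j; rewrite -!iterzD. Qed.

Lemma same_row_sym n x y : same_row n x y -> same_row n y x.
Proof. by move=> E k; rewrite E. Qed.

Lemma same_row_trans n y x z : same_row n x y -> same_row n y z -> same_row n x z.
Proof. by move=> E E' k; rewrite E. Qed.

Lemma same_row_eq x y : (forall n, same_row n x y) -> x = y.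
Proof. by move=> E; apply: (coding_inj (t := T)) => n; exact: (E n 0%R). Qed.

Lemma row_periodP n p x : row_period n p x <-> same_row n (iterz f p%:Z x) x.
Proof. by split=> E k; have := E k; rewrite -iterzD. Qed.

Lemma row_period_mod n p x (i : int) : 0 < p -> row_period n p x ->
  `|(i %% p%:Z)%Z|%N < p /\
  same_row n (iterz f i x) (iterz f `|(i %% p%:Z)%Z|%N%:Z x).
Proof.
move=> p0 px.
have pxm (m : nat) k : pi n (iterz f (k + (m * p)%N%:Z)%R x) = pi n (iterz f k x).
  elim: m => [|m IH]; first by rewrite mul0n addr0.
  rewrite -IH -(px (k + (m * p)%N%:Z)%R).
  by congr (pi n (iterz f _ x)); rewrite mulSn; lia.
have pxz (m : int) k : pi n (iterz f (k + m * p%:Z)%R x) = pi n (iterz f k x).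
  case: m => m; first exact: (pxm m k).
  rewrite -(pxm m.+1); congr (pi n (iterz f _ x)).
  by rewrite NegzE PoszM mulNr subrK.
have lt_mod : ((i %% p%:Z)%Z < p%:Z)%R by rewrite ltz_pmod// ltz_nat.
have ge0_mod : (0 <= (i %% p%:Z)%Z)%R by rewrite modz_ge0//; lia.
have iE := divz_eq i p%:Z.
split; first by lia.
move=> k; rewrite -!iterzD.
by rewrite gez0_abs// [in LHS]iE [(_ * _ + _)%R]addrC addrA pxz.
Qed.

Definition row_orbit n x : set X := [set y | exists i, same_row n y (iterz f i x)].

(** The set is closed because a periodic row has finitely many shifts. *)
Lemma closed_invariant_row_orbit n p x : 0 < p -> row_period n p x ->
  closed_invariant f (row_orbit n x).
Proof.
move=> p0 px; apply/closed_invariantP; split.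
- by exists x, 0%R.
- have -> : row_orbit n x =
      \bigcup_(j in `I_p) [set y | same_row n y (iterz f j%:Z x)].
    apply/seteqP; split=> [y [i yi]|y [j _ yj]]; last by exists (Posz j).
    have [jp ij] := row_period_mod i p0 px.
    by exists `|(i %% p%:Z)%Z|%N => //=; exact: same_row_trans ij.
  by apply: closed_bigcup => // j _; exact: closed_same_row.
- move=> y; split=> -[i yi].
    exists (i - 1)%R; have /(same_row_iterz (-1)) := yi.
    rewrite -iterzD addrC => E k; rewrite -E.
    by congr (pi n (iterz f k _)); rewrite -[f y]/(iterz f 1 y) -iterzD.
  exists (i + 1)%R; rewrite addrC iterzD => k.
  exact: (same_row_iterz 1 yi).
Qed.

Lemma minimal_row_orbit n p x (M : set X) y z : 0 < p -> row_period n p x ->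
  minimal_set f M -> M `<=` row_orbit n x -> M y -> M z ->
  exists i, same_row n y (iterz f i z).
Proof.
move=> p0 px minM Mx /Mx[i yi] /Mx[j zj]; exists (i - j)%R => k.
rewrite yi -!iterzD.
have := zj (k + (i - j))%R; rewrite -!iterzD => ->.
by congr (pi n (iterz f _ x)); lia.
Qed.

Lemma same_tower n x y : (pi n x).1 = (pi n y).1 ->
  exists k, pi n (iterz f k x) = pi n y.
Proof.
move=> E; have lt : (pi n y).2 < height (pi n x).1.
  by rewrite E; have [] := coding_step T n y.
have [k kE] := row_tower (row_coding T n x) (n := 0%R) (surjective_pairing _) lt.
by exists k; rewrite kE E -surjective_pairing.
Qed.

(** If the sets shared a label at every level, compactness would yield a point of [M] all of whose
    labels occur in [N], and then a point of [N] with exactly these labels, that is, a common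
    point. *)
Lemma minimal_sets_separated (M N : set X) : minimal_set f M -> minimal_set f N ->
  M <> N -> exists n, forall x y, M x -> N y -> pi n x <> pi n y.
Proof.
move=> minM minN MN; apply: contrapT => /forallNP nsep; apply: MN.
have clM : closed M by case: minM => -[].
have clN : closed N by case: minN => -[].
have meet n : exists x y, [/\ M x, N y & pi n x = pi n y].
  apply: contrapT => nomeet; apply: (nsep n) => x y Mx Ny E; apply: nomeet.
  by exists x, y.
have [||n|x xA] := compact_nested cptX
    (A := fun n => M `&` [set x | exists2 y, N y & pi n x = pi n y]).
- move=> n; apply: closedI => //.
  exact: (@closed_coding n 0%R (fun v => exists2 y, N y & v = pi n y)).
- by move=> n; have [x [y [Mx Ny E]]] := meet n; exists x; split => //; exists y.
- move=> x [Mx [y Ny E]]; split => //; exists y => //.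
  exact: (@coding_le _ _ T n n.+1).
have [||n|y yB] := compact_nested cptX
    (A := fun n => N `&` [set y | pi n y = pi n x]).
- move=> n; apply: closedI => //.
  exact: (@closed_coding n 0%R (fun v => v = pi n x)).
- by move=> n; have [_ [y Ny E]] := xA n; exists y; split.
- by move=> y [Ny E]; split => //; exact: (@coding_le _ _ T n n.+1).
have yx : y = x by apply: (coding_inj (t := T)) => n; have [] := yB n.
have [Mx _] := xA 0; have [Ny _] := yB 0; rewrite yx in Ny.
exact: minimal_sets_disjoint minM minN Mx Ny.
Qed.


(** If no set recurred, the sequence would contain [K.+1] distinct sets, separated at a common
    level. At a higher level with at most [K] towers two of them visit the same tower, and moving
    along it gives them a common label. *)
Lemma minimal_sets_finite K (Ms : nat -> set X) : bounded_rank T K ->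
  (forall n, minimal_set f (Ms n)) ->
  exists M, forall n, exists2 m, n <= m & Ms m = M.
Proof.
move=> rankK minM; apply: contrapT => /forallNP nrec.
have /choice[nb nbP] : forall M, exists n, forall m, n <= m -> Ms m <> M.
  move=> M; apply: contrapT => /forallNP no; apply: (nrec M) => n.
  apply: contrapT => no'; apply: (no n) => m nm MsM; apply: no'.
  by exists m.
have distinct j : exists g : nat -> nat,
    forall a b, a < b -> b < j -> Ms (g a) <> Ms (g b).
  elim: j => [|j [g gP]]; first by exists id.
  (* This index lies beyond every occurrence of the sets already chosen. *)
  pose m := \max_(a < j) nb (Ms (g a)).
  exists (fun a => if a == j then m else g a) => a b ab.
  rewrite ltnS leq_eqVlt => /orP[/eqP bj|bj].
    subst b; rewrite eqxx ltn_eqF//; apply/nesym/nbP.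
    exact: (@leq_bigmax _ (fun a : 'I_j => nb (Ms (g a))) (Ordinal ab)).
  by rewrite !ltn_eqF// ?(ltn_trans ab bj)//; exact: gP.
have [g gP] := distinct K.+1.
have /choice[sep sepP] : forall ab : 'I_K.+1 * 'I_K.+1, exists n,
    ab.1 < ab.2 -> forall x y, Ms (g ab.1) x -> Ms (g ab.2) y -> pi n x <> pi n y.
  move=> [a b]; have [ab|ab] := boolP (a < b); last by exists 0.
  have [n nP] := minimal_sets_separated (minM (g a)) (minM (g b))
    (gP a b ab (ltn_ord b)).
  by exists n.
pose N := \max_ab sep ab.
have [m Nm mK] := rankK N.
have /choice[x xP] : forall a : nat, exists x, Ms (g a) x.
  by move=> a; have [[]] := minM (g a).
have /injectivePn[a [b ab uab]] :
    ~~ injectiveb (fun a : 'I_K.+1 => (pi m (x a)).1).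
  by apply/negP => /injectiveP/leq_card; rewrite card_ord leqNgt ltnS mK.
wlog lt_ab : a b ab uab / a < b.
  move=> wl; have := ab; rewrite -val_eqE /= neq_ltn => /orP[|] lt.
    exact: wl uab lt.
  by apply: (wl b a) => //; rewrite eq_sym.
have [k kE] := same_tower uab.
apply: (sepP (a, b) lt_ab (iterz f k (x a)) (x b)) => //.
  by have [ciM _] := minM (g a); apply/(closed_invariant_iterz k (x a) ciM).
by apply: coding_le kE; apply: leq_trans Nm; exact: (leq_bigmax (a, b)).
Qed.

(* Suppose that [x] follows the orbit of [z] at level [n], but leaves it at level
   [n'].  The tower of [x] at a high level then only visits the orbit of [z] at level
   [n], but not at level [n'].  So the points that leave the orbit of [z] at different
   levels have different towers. *)
Lemma periodic_isolated K p z : bounded_rank T K -> 0 < p -> iterz f p%:Z z = z ->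
  ~ forall n, exists2 x, x <> z & same_row n x z.
Proof.
move=> rankK p0 pz allx.
have modp k : exists2 j : nat, j < p & iterz f k z = iterz f j%:Z z.
  have prow n : row_period n p z by apply/row_periodP; rewrite pz.
  have H n := row_period_mod k p0 (prow n).
  exists `|(k %% p%:Z)%Z|%N.
    by have [] := H 0.
  by apply: same_row_eq => n; have [] := H n.
(* The level [n0] tells apart the points of the finite orbit of [z]. *)
have [n0 n0P] : exists n0, forall k l,
    pi n0 (iterz f k z) = pi n0 (iterz f l z) -> iterz f k z = iterz f l z.
  have /choice[sep sepP] : forall ij : 'I_p * 'I_p, exists n,
      pi n (iterz f ij.1%:Z z) = pi n (iterz f ij.2%:Z z) ->
      iterz f ij.1%:Z z = iterz f ij.2%:Z z.
    move=> ij; apply: contrapT => /forallNP no.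
    apply: (no 0) => _; apply: (coding_inj (t := T)) => n; apply: contrapT => E.
    by apply: (no n) => /E.
  exists (\max_ij sep ij) => k l.
  have [i ip ->] := modp k; have [j jp ->] := modp l => E.
  apply: (sepP (Ordinal ip, Ordinal jp)); apply: coding_le E.
  exact: (leq_bigmax (Ordinal ip, Ordinal jp)).
pose S n v := exists k, v = pi n (iterz f k z).
(* For [n >= n0], [nx n] is a point with the row of [z] at level [n], together with a higher level
   where its label is off the orbit of [z]. Without such a level, the choice of [n0] would force the
   point to be [z]. *)
have /choice[nx nxP] : forall n, exists mx : nat * X, n0 <= n ->
    [/\ n < mx.1, same_row n mx.2 z & ~ S mx.1 (pi mx.1 mx.2)].
  move=> n; have [x xz xn] := allx n.
  have [n0n|_] := leqP n0 n; last by exists (0, x).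
  apply: contrapT => /forallNP no; apply: xz.
  have Sx n' : n < n' -> S n' (pi n' x).
    by move=> nn'; apply: contrapT => nS; apply: (no (n', x)).
  apply: (coding_inj (t := T)) => n'.
  suff {n'} E n' : n < n' -> pi n' x = pi n' z.
    have [/E//|n'n] := ltnP n n'.
    by apply: (@coding_le _ _ T n' n.+1); [exact: leqW|exact: E].
  move=> nn'; have [k kE] := Sx n' nn'.
  rewrite kE; congr pi; apply: (n0P k 0%R).
  apply: (coding_le n0n); rewrite -(xn 0%R).
  exact/esym/(coding_le (ltnW nn') kE).
(* Each level is the one where the previous point has left the orbit of [z]; the later points still
   follow the orbit there. *)
pose l i := iter i (fun n => (nx n).1) n0.
have l0 i : n0 <= l i.
  by elim: i => // i IH; have [/ltnW lt _ _] := nxP _ IH; exact: leq_trans lt.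
have lS i : l i < l i.+1 by have [] := nxP _ (l0 i).
have lle i j : i <= j -> l i <= l j.
  move/subnK <-; elim: (j - i) => // k IH.
  by apply: leq_trans IH _; rewrite addSn ltnW.
have [m lm mK] := rankK (l K.+1).
have /injectivePn[i [j ij uij]] :
    ~~ injectiveb (fun i : 'I_K.+1 => (pi m (nx (l i)).2).1).
  by apply/negP => /injectiveP/leq_card; rewrite card_ord leqNgt ltnS mK.
wlog lt_ij : i j ij uij / i < j.
  move=> wl; have := ij; rewrite -val_eqE /= neq_ltn => /orP[|] lt.
    exact: wl uij lt.
  by apply: (wl j i) => //; rewrite eq_sym.
(* Within the common tower, the [j]-th point moves to the label of the [i]-th one. At level [l i.+1]
   its label is on the orbit of [z], while that of the [i]-th point is not. *)
have [_ _ nS] := nxP _ (l0 i); have [_ same _] := nxP _ (l0 j).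
apply: nS; have [k kE] := same_tower (esym uij).
exists k; rewrite -[_.1]/(l i.+1).
have le_j : l i.+1 <= l j by exact: lle.
rewrite -(coding_le _ kE); last by apply: leq_trans lm; exact: lle.
by apply: (coding_le le_j); exact: same.
Qed.

End Coding.

(** * Odometers *)

Section DiscreteProduct.
Local Open Scope classical_set_scope.

Lemma continuous_discrete_product (Y : topologicalType) (I : nat -> choiceType)
    (g : Y -> prod_topology (fun k => discrete_topology (I k))) :
  (forall k y, \forall y' \near y, g y' k = g y k) -> continuous g.
Proof.
move=> gk y; apply/cvg_sup => k U [W [[N oN <-]] Ny NU].
by apply: filterS (gk k y) => y' E; apply: NU; rewrite /= E.
Qed.

Lemma near_discrete_product (I : nat -> choiceType)
    (A : set (prod_topology (fun k => discrete_topology (I k))))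
    (x : set_type A) k :
  \forall y \near x, val y k = val x k.
Proof.
have cval : continuous (val : set_type A -> _) by exact: initial_continuous.
have := continuous_comp (cval x)
  (@proj_continuous nat (fun k => discrete_topology (I k)) k (val x)).
move=> /(_ [set val x k]); apply.
by rewrite /nbhs /=; apply/principal_filterP.
Qed.

End DiscreteProduct.

Section Odometer.
Local Open Scope classical_set_scope.
Variables (X : topologicalType) (f : homeo X X) (T : tower_coding f).
Hypothesis cptX : compact [set: X].
Variables (M : set X) (z : X).
Hypotheses (ciM : closed_invariant f M) (Mz : M z).
Hypothesis periodic : forall n, exists2 p, 0 < p & row_period T n p z.
Hypothesis orbit_rows :
  forall n y, M y -> exists i, same_row T n y (iterz f i z).

Local Notation row_period := (@row_period X f T).
Local Notation same_row := (@same_row X f T).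

(** The remainder of [i] modulo the least period is again a period, hence zero. *)
Lemma least_period : exists p : nat -> nat, forall n,
  [/\ 0 < p n, row_period n (p n) z &
    forall i, same_row n (iterz f i z) z -> (p n %| `|i|)%N].
Proof.
suff /choice[p pP] : forall n, exists p, [/\ 0 < p, row_period n p z &
    forall i, same_row n (iterz f i z) z -> (p %| `|i|)%N] by exists p.
move=> n; have exp : exists p, (0 < p) && `[< row_period n p z >].
  by have [p p0 pz] := periodic n; exists p; rewrite p0; apply/asboolP.
case: (ex_minnP exp) => p /andP[p0 /asboolP pz] pmin.
exists p; split => // i iz.
have [lt iz'] := row_period_mod i p0 pz.
have p_i : row_period n `|(i %% p%:Z)%Z|%N z.
  by apply/row_periodP; apply: same_row_trans iz; exact: same_row_sym.
have i0 : `|(i %% p%:Z)%Z|%N = 0.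
  apply/eqP; rewrite -leqn0 leqNgt; apply/negP => gt0.
  have : p <= `|(i %% p%:Z)%Z|%N by apply: pmin; rewrite gt0; apply/asboolP.
  by rewrite leqNgt lt.
suff : (p%:Z %| i)%Z by rewrite /dvdz /=.
by apply/dvdz_mod0P/eqP; rewrite -absz_eq0 i0.
Qed.

(** The coordinate of a point at level [n] is the shift, modulo the least period [p n], that takes
    the row of [z] to its own. *)
Lemma minimal_odometer : ~ (exists2 p, 0 < p & forall n, row_period n p z) ->
  odometer_on f M.
Proof.
move=> unbounded; have [p pP] := least_period.
have p_gt0 n : 0 < p n by have [] := pP n.
have p_dvd n : (p n %| p n.+1)%N.
  have [_ _ H] := pP n; have [_ /row_periodP E _] := pP n.+1.
  by apply: (H (Posz (p n.+1))); exact: same_row_le E.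
have p_le n m : n <= m -> p n <= p m.
  move/subnK <-; elim: (m - n) => // k IH.
  by apply: leq_trans IH _; apply: dvdn_leq => //; exact: p_dvd.
(* If the periods were bounded by [A], the factorial of [A] would be a period at every level. *)
have p_cvg : p k @[k --> \oo] --> \oo.
  apply/cvgnyPge => A; apply: contrapT => nA; apply: unbounded.
  have p_lt n : p n <= A.
    rewrite leqNgt; apply/negP => An; apply: nA; exists n => // k /= nk.
    by rewrite (leq_trans (ltnW An))// p_le.
  exists A`!; first exact: fact_gt0.
  move=> n; have [p0 pz _] := pP n.
  have /dvdnP[m ->] : (p n %| A`!)%N by apply: dvdn_fact; rewrite p0 p_lt.
  apply/row_periodP; have [_] := row_period_mod (m * p n)%N p0 pz.
  by rewrite PoszM modzMl.
pose s := Scale p_dvd p_cvg.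
have idx_ex n (y : set_type M) : exists i : 'I_(p n), same_row n (val y) (iterz f i z).
  have [p0 pz _] := pP n; have [i yi] := orbit_rows n (set_valP y).
  have [lt iz] := row_period_mod i p0 pz.
  by exists (Ordinal lt); exact: same_row_trans iz.
have /choice[idx0 idx0P] : forall ny : nat * set_type M, exists i : nat,
    i < p ny.1 /\ same_row ny.1 (val ny.2) (iterz f i z).
  by move=> [n y]; have [i iP] := idx_ex n y; exists i.
pose idx n y : 'I_(p n) := Ordinal (proj1 (idx0P (n, y))).
have idxP n (y : set_type M) : same_row n (val y) (iterz f (idx n y) z).
  exact: (proj2 (idx0P (n, y))).
have idxE n (y : set_type M) (j : nat) : same_row n (val y) (iterz f j z) ->
    (idx n y : nat) = j %% p n.
  move=> yj; have [p0 pz H] := pP n.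
  have /H : same_row n (iterz f ((idx n y)%:Z - j%:Z)%R z) z.
    have : same_row n (iterz f (idx n y) z) (iterz f j z).
      by apply: same_row_trans yj; exact/same_row_sym/idxP.
    move=> /(same_row_iterz (- j%:Z)).
    by rewrite -!iterzD addNr addrC.
  move=> dvd; rewrite -[LHS](modn_small (ltn_ord (idx n y))).
  apply/eqP; case: (leqP j (idx n y)) => le.
    by rewrite eqn_mod_dvd//; move: dvd; rewrite distnEl.
  by rewrite eq_sym eqn_mod_dvd ?(ltnW le)//; move: dvd; rewrite distnEr// ltnW.
have odo (y : set_type M) : (fun k => idx k y) \in @odometer_set s.
  apply/mem_set => k /=; have [p0 _ _] := pP k.
  change ((idx k.+1 y : nat) %% p k = (idx k y : nat) %% p k).
  rewrite [RHS]modn_small//; apply/esym/idxE.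
  exact: (same_row_le (leqnSn k) (idxP k.+1 y)).
pose hh (y : set_type M) : odometer_space s := SigSub (odo y).
have hinj : injective hh.
  move=> y y' /(congr1 val)/= E; apply/val_inj/(same_row_eq (T := T)) => n.
  apply: (same_row_trans (idxP n y)); apply: same_row_sym.
  by have := idxP n y'; rewrite -[idx n y']/((fun k => idx k y') n) -E.
have row_mod n (i : nat) : same_row n (iterz f i z) (iterz f (i %% p n)%N z).
  have [p0 pz _] := pP n; have [_] := row_period_mod i p0 pz.
  by rewrite modz_nat.
pose coord (x : odometer_space s) n : 'I_(p n) := val x n.
have coordS x n : (coord x n.+1 : nat) %% p n = coord x n.
  rewrite -[RHS](modn_small (ltn_ord (coord x n))).
  exact: (set_valP x n).
(* Compactness in the form used twice: with the whole space for surjectivity, and with the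
   complement of an open set for continuity of the inverse. *)
have nested (x : odometer_space s) (U : set X) : closed U ->
    (forall n, exists2 y, M y & U y /\ same_row n y (iterz f (coord x n) z)) ->
    exists2 y : set_type M, U (val y) & hh y = x.
  move=> clU Une.
  have [n|n|n|y yP] := compact_nested cptX (A := fun n =>
    M `&` (U `&` [set y | same_row n y (iterz f (coord x n) z)])).
  - have [_ clM _] := ciM.
    by apply: closedI => //; apply: closedI => //; exact: closed_same_row.
  - by have [y My [Uy yx]] := Une n; exists y.
  - move=> y [My [Uy yx]]; split => //; split => //=.
    rewrite -coordS; apply: same_row_trans (row_mod _ _).
    exact: same_row_le yx.
  have [My [Uy _]] := yP 0.
  exists (SigSub (mem_set My)) => //.
  apply/val_inj/functional_extensionality_dep => n; apply/val_inj => /=.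
  rewrite -[RHS]/(coord x n : nat) -[RHS](modn_small (ltn_ord (coord x n))).
  by apply: idxE => /=; have [_ [_]] := yP n.
have hsurj x : exists y, hh y = x.
  have [|n|y _ yx] := nested x setT; [exact: closedT| |by exists y].
  by exists (iterz f (coord x n) z) => //; exact/closed_invariant_iterz.
have {hsurj} [hinv hinvK] := choice hsurj.
have hK : cancel hh hinv by move=> y; apply: hinj; rewrite hinvK.
have near_idx n (y : set_type M) : \forall y' \near y, idx n y' = idx n y.
  (* The points with another residue form a finite union of closed sets, so the complement is a
     neighbourhood of [y]. *)
  pose C := \bigcup_(j in [set j | j < p n /\ j <> idx n y])
    [set x | same_row n x (iterz f j z)].
  have oC : open (~` C).
    apply/closed_openC/closed_bigcup => [|j _]; last exact: closed_same_row.
    by apply: (@sub_finite_set _ _ `I_(p n)) => // j [].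
  have Cy : (~` C) (val y).
    by move=> [j [jp jy] /idxE]; rewrite modn_small// => yj; apply: jy.
  have Ny : nbhs y ((val : set_type M -> X) @^-1` (~` C)).
    exact: (@initial_continuous _ _ (val : set_type M -> X) y _
      (open_nbhs_nbhs (conj oC Cy))).
  apply: filterS Ny => y' Cy'; apply/val_inj; apply: contrapT => neq; apply: Cy'.
  by exists (idx n y'); [split => //; exact: ltn_ord|exact: idxP].
have hcont : continuous hh.
  apply: continuous_comp_initial.
  by apply: continuous_discrete_product => n y; exact: near_idx.
have hinv_cont : continuous hinv.
  apply: continuous_comp_initial => x U; rewrite nbhsE => -[N [oN Nx] NU].
  have [n nP] : exists n, forall y : set_type M,
      same_row n (val y) (iterz f (coord x n) z) -> N (val y).
    apply: contrapT => /forallNP no.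
    have [||y Ny yx] := nested x (~` N); first exact: open_closedC.
      move=> n; apply: contrapT => nex; apply: (no n) => y yn.
      apply: contrapT => Ny; apply: nex; exists (val y) => //.
      exact: set_valP.
    by apply: Ny; rewrite -(hK y) yx.
  apply: filterS (near_discrete_product x n) => x' xx'; apply: NU; apply: nP.
  have := idxP n (hinv x'); rewrite -[idx n _]/(coord (hh (hinv x')) n).
  by rewrite hinvK /coord xx'.
have gM (y : set_type M) : f (val y) \in M.
  apply/mem_set; have /closed_invariantP[_ _ fM] := ciM.
  by apply/fM; exact: set_valP.
pose g (y : set_type M) : set_type M := SigSub (gM y).
exists g => //; exists s.
exists (Homeo hK hinvK hcont hinv_cont) => y /=.
apply/val_inj/functional_extensionality_dep => n; apply/val_inj => /=.
apply: (@idxE n (g y) (idx n y).+1) => /=.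
exact: (same_row_iterz 1 (idxP n y)).
Qed.

End Odometer.

(** * Bratteli diagrams *)

Section IncomingEdges.
Variables (B : ordered_bratteli) (n : nat).
Implicit Types e : edge B n.

Definition incoming (v : vertex B n.+1) : seq (edge B n) :=
  sort (@edge_le B n) (enum [pred e | tgt e == v]).

Definition position e := index e (incoming (tgt e)).

Lemma mem_incoming v e : (e \in incoming v) = (tgt e == v).
Proof. by rewrite mem_sort mem_enum. Qed.

Lemma uniq_incoming v : uniq (incoming v).
Proof. by rewrite sort_uniq enum_uniq. Qed.

Lemma sorted_incoming v : sorted (@edge_le B n) (incoming v).
Proof.
apply: (@sort_sorted_in _ [pred e | tgt e == v]).
  by move=> e e' /eqP te /eqP te'; apply/edge_le_comparable; rewrite te.
by apply/allP => e; rewrite mem_enum.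
Qed.

Lemma position_lt e : position e < size (incoming (tgt e)).
Proof. by rewrite index_mem mem_incoming. Qed.

Lemma nth_position e d : nth d (incoming (tgt e)) (position e) = e.
Proof. by rewrite nth_index// mem_incoming. Qed.

Lemma position_le e e' : tgt e = tgt e' ->
  (position e <= position e') = edge_le e e'.
Proof.
move=> te; have ein : e \in incoming (tgt e) by rewrite mem_incoming.
have e'in : e' \in incoming (tgt e) by rewrite mem_incoming te.
have le_index := sorted_leq_index (@edge_le_trans B n) (@edge_le_refl B n)
  (sorted_incoming (tgt e)).
rewrite /position -te; apply/idP/idP => [|le]; first exact: le_index.
rewrite leqNgt; apply/negP => lt.
have le' := le_index _ _ e'in ein (ltnW lt).
by have E : e = e' by [apply: (@edge_le_anti B n); rewrite le le'];
  rewrite E ltnn in lt.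
Qed.

Lemma position_inj e e' : tgt e = tgt e' -> position e = position e' -> e = e'.
Proof. by move=> te pe; rewrite -(nth_position e e) te pe nth_position. Qed.

Lemma maximal_position e :
  maximal_edge e <-> (position e).+1 = size (incoming (tgt e)).
Proof.
split=> [emax|pe e' te le]; last first.
  apply: position_inj => //; apply/eqP; rewrite eqn_leq [X in _ && X]position_le// le.
  by rewrite andbT -ltnS pe -te position_lt.
apply/eqP; rewrite eqn_leq position_lt/= leqNgt; apply/negP => lt.
pose e' := nth e (incoming (tgt e)) (position e).+1.
have te' : tgt e' = tgt e by apply/eqP; rewrite -mem_incoming mem_nth.
have pe' : position e' = (position e).+1.
  by rewrite /position te' index_uniq// uniq_incoming.
have : e' = e by apply: emax => //; rewrite -position_le// pe'.
by move=> E; move: pe'; rewrite E => /n_Sn.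
Qed.

Lemma minimal_position e : minimal_edge e -> position e = 0.
Proof.
move=> emin; pose e' := nth e (incoming (tgt e)) 0.
have lt : 0 < size (incoming (tgt e)) by exact: leq_ltn_trans (position_lt e).
have te' : tgt e' = tgt e by apply/eqP; rewrite -mem_incoming mem_nth.
have pe' : position e' = 0 by rewrite /position te' index_uniq// uniq_incoming.
by rewrite -(emin e')// -position_le// pe'.
Qed.

Lemma successor_position e e' :
  successor_edge e e' -> position e' = (position e).+1.
Proof.
move=> [te le neq least].
have lt : position e < position e'.
  rewrite ltn_neqAle position_le// le andbT; apply/eqP => E.
  by apply: neq; apply: position_inj.
apply/eqP; rewrite eqn_leq lt andbT.
have szlt : (position e).+1 < size (incoming (tgt e)).
  by apply: leq_ltn_trans lt _; rewrite -te position_lt.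
pose e2 := nth e (incoming (tgt e)) (position e).+1.
have te2 : tgt e2 = tgt e by apply/eqP; rewrite -mem_incoming mem_nth.
have pe2 : position e2 = (position e).+1.
  by rewrite /position te2 index_uniq// uniq_incoming.
rewrite -pe2 position_le ?te2//; apply: least => //.
  by rewrite -position_le// pe2.
by move=> E; move: pe2; rewrite E => /n_Sn.
Qed.

End IncomingEdges.

Section PathCoding.
Local Open Scope classical_set_scope.
Variable B : ordered_bratteli.
Implicit Types p q : path_space B.

Definition vertex_word n (v : vertex B n.+1) : seq (vertex B n) :=
  map (@src B n) (incoming v).

(** The number of paths from the top vertex to the given one. *)
Fixpoint tower_height n : vertex B n -> nat :=
  if n is m.+1 then lift_height (@tower_height m) (@vertex_word m)
  else fun=> 1.

Definition initial_word n (e : edge B n) : seq (vertex B n) :=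
  map (@src B n) (take (position e) (incoming (tgt e))).

(* The number of paths that precede the first [n] edges of [p] among the paths
   with the same endpoint. *)
Fixpoint tower_rank n p : nat :=
  if n is m.+1 then
    size (expand (@tower_height m) (initial_word (path_edge p m))) + tower_rank m p
  else 0.

(** Taking the source of the next edge treats level 0 like the others. *)
Definition path_vertex p n : vertex B n := src (path_edge p n).

Definition path_coding n p := (path_vertex p n, tower_rank n p).

Lemma path_vertexS p n : path_vertex p n.+1 = tgt (path_edge p n).
Proof. by rewrite /path_vertex -(set_valP p n). Qed.

Lemma vertex_word_split n (e : edge B n) : vertex_word (tgt e) =
  initial_word e ++ src e ::
    map (@src B n) (drop (position e).+1 (incoming (tgt e))).
Proof.
rewrite /vertex_word -{1}(cat_take_drop (position e) (incoming (tgt e))).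
by rewrite map_cat (drop_nth e) ?position_lt// nth_position.
Qed.

Lemma initial_word_position n (e e' : edge B n) : tgt e' = tgt e ->
  position e' = (position e).+1 -> initial_word e' = rcons (initial_word e) (src e).
Proof.
move=> te pe; rewrite /initial_word te pe (take_nth e) ?map_rcons ?nth_position//.
exact: position_lt.
Qed.

Lemma vertex_word_nonerasing n : nonerasing (@vertex_word n).
Proof.
move=> v; have [e <-] := @tgt_surj B n v.
by rewrite vertex_word_split; case: (initial_word e).
Qed.

Lemma tower_height_gt0 n v : 0 < @tower_height n v.
Proof.
elim: n v => [//|n IH] v /=.
exact: (lift_height_gt0 IH (@vertex_word_nonerasing n)).
Qed.

Lemma tower_heightS n (e : edge B n) : tower_height (tgt e) =
  size (expand (@tower_height n) (initial_word e)) + tower_height (src e) +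
  size (expand (@tower_height n)
    (map (@src B n) (drop (position e).+1 (incoming (tgt e))))).
Proof.
rewrite /= /lift_height vertex_word_split expand_cat expand_cons !size_cat.
by rewrite size_map size_iota addnA.
Qed.

Lemma tower_rank_lt n p : tower_rank n p < tower_height (path_vertex p n).
Proof.
elim: n => [//|n IH]; rewrite path_vertexS tower_heightS /=.
by move: IH; rewrite /path_vertex; lia.
Qed.

Lemma path_coding_proj n d p :
  proj (@tower_height n) (@vertex_word n) d (path_coding n.+1 p) = path_coding n p.
Proof.
rewrite /proj /path_coding path_vertexS /= vertex_word_split nth_expand//.
exact: tower_rank_lt.
Qed.

(** If two paths reached the same vertex by different edges, the rank of the later one would count
    the whole tower under the earlier edge and so exceed the other rank. *)
Lemma path_coding_inj p q : (forall n, path_coding n p = path_coding n q) -> p = q.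
Proof.
move=> E; apply/val_inj/functional_extensionality_dep => n.
rewrite -[val p n]/(path_edge p n) -[val q n]/(path_edge q n).
have := E n.+1; rewrite /path_coding !path_vertexS => -[te rE].
apply: position_inj => //.
wlog lt : p q te rE {E} / position (path_edge p n) < position (path_edge q n).
  move=> wl; case: (ltngtP (position (path_edge p n)) (position (path_edge q n))) => //.
    exact: wl.
  by move=> lt; apply/esym/wl.
exfalso; have lt_p := tower_rank_lt n p.
move: rE => /eqP; rewrite ltn_eqF//=.
have -> : initial_word (path_edge q n) =
    rcons (initial_word (path_edge p n)) (path_vertex p n) ++
    map (@src B n) (drop (position (path_edge p n)).+1
      (take (position (path_edge q n)) (incoming (tgt (path_edge q n))))).
  rewrite /initial_word -te -{1}(cat_take_drop (position (path_edge p n)).+1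
    (take (position (path_edge q n)) _)) map_cat; congr (_ ++ _).
  rewrite take_takel// (take_nth (path_edge p n)) ?position_lt//.
  by rewrite map_rcons nth_position.
rewrite -cats1 !expand_cat !size_cat size_map size_iota; lia.
Qed.

Lemma near_path_edge p n : \forall q \near p, path_edge q n = path_edge p n.
Proof. exact: near_discrete_product. Qed.

Lemma path_coding_locally_constant n p :
  \forall q \near p, path_coding n q = path_coding n p.
Proof.
have near_rank : \forall q \near p, tower_rank n q = tower_rank n p.
  elim: n => [|n IH]; first by apply: filterE => q /=.
  by apply: filterS2 IH (near_path_edge p n) => q /= -> ->.
apply: filterS2 near_rank (near_path_edge p n) => q rE eE.
by rewrite /path_coding rE /path_vertex eE.
Qed.

End PathCoding.

Section VershikCoding.
Variables (B : ordered_bratteli) (phi : path_space B -> path_space B).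
Hypothesis vershik : vershik_map phi.
Implicit Types p : path_space B.

Lemma tower_rank_maximal n p : (forall i, i < n -> maximal_edge (path_edge p i)) ->
  (tower_rank n p).+1 = tower_height (path_vertex p n).
Proof.
elim: n => [//|n IH] pmax; rewrite path_vertexS tower_heightS /=.
have /maximal_position E := pmax n (ltnSn n).
by rewrite E drop_size /= -addnS IH// => [|i lt]; [rewrite addn0|apply/pmax/ltnW].
Qed.

Lemma tower_rank_minimal n p :
  (forall i, i < n -> minimal_edge (path_edge p i)) -> tower_rank n p = 0.
Proof.
elim: n => [//|n IH] pmin /=; rewrite IH => [|i lt]; last exact/pmin/ltnW.
by rewrite /initial_word minimal_position ?take0//; exact: pmin.
Qed.

(** Up to level [k] the path is at the top of its tower and its image at the bottom of the next one,
    so the rank grows by one at level [k.+1]; the edges above are unchanged. *)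
Lemma vershik_nonmaximal k n p :
  (forall i, i < k -> maximal_edge (path_edge p i)) ->
  ~ maximal_edge (path_edge p k) -> k < n ->
  path_vertex (phi p) n = path_vertex p n /\
  tower_rank n (phi p) = (tower_rank n p).+1.
Proof.
move=> pmax pk; have [_ /(_ p k pmax pk)[phimin succ phiE]] := vershik.
elim: n => [//|n IH]; rewrite ltnS leq_eqVlt => /orP[/eqP kn|kn].
  subst k; have [te _ _ _] := succ; split; first by rewrite !path_vertexS.
  rewrite /= (initial_word_position te (successor_position succ)).
  rewrite (tower_rank_minimal phimin) -cats1 expand_cat size_cat size_expand1.
  by rewrite -(tower_rank_maximal pmax) addn0 addnS.
by have [_ /= ->] := IH kn; rewrite !path_vertexS phiE// addnS.
Qed.

Lemma path_coding_step n p :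
  step (@tower_height B n) (path_coding n p) (path_coding n (phi p)).
Proof.
split; first exact: tower_rank_lt.
rewrite /=; have [[k [kn kmax knmax]]|nok] := pselect (exists k, [/\ k < n,
    forall i, i < k -> maximal_edge (path_edge p i) &
    ~ maximal_edge (path_edge p k)]).
  have [vE rE] := vershik_nonmaximal kmax knmax kn.
  by rewrite -rE -vE tower_rank_lt.
(* Now the path is at the top of its tower of level [n]. Its image starts with minimal edges,
   whether the whole path is maximal or its first nonmaximal edge lies at [n] or higher. *)
have pmax i : i < n -> maximal_edge (path_edge p i).
  elim/ltn_ind: i => i IH lt; apply: contrapT => nmax; apply: nok.
  by exists i; split => // j ji; apply: IH => //; exact: ltn_trans lt.
rewrite (tower_rank_maximal pmax) ltnn; apply: tower_rank_minimal => i ilt.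
have [[phiM _ _] phiE] := vershik.
have [allmax|/existsNP[m nm]] :=
  pselect (forall m, maximal_edge (path_edge p m)); first exact: phiM.
have exm : exists m, `[< ~ maximal_edge (path_edge p m) >] by exists m; apply/asboolP.
case: (ex_minnP exm) => k /asboolP knmax kmin.
have kmax j : j < k -> maximal_edge (path_edge p j).
  move=> jk; apply: contrapT => /asboolP/kmin; rewrite leqNgt jk//.
have [phimin _ _] := phiE p k kmax knmax; apply: phimin.
by apply: leq_trans ilt _; rewrite leqNgt; apply/negP => /pmax.
Qed.

End VershikCoding.

Definition representation_coding (X : topologicalType) (f : homeo X X)
    (B : ordered_bratteli) (phi : path_space B -> path_space B)
    (vershik : vershik_map phi) (g : homeo X (path_space B))
    (gf : forall x, g (f x) = phi (g x)) : tower_coding f.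
Proof.
refine (@TowerCoding X f (vertex B) (@tower_height B) (@vertex_word B)
  (fun n x => path_coding n (g x)) (@tower_height_gt0 B) (@vertex_word_nonerasing B)
  (fun n => erefl) _ _ _ _).
- by move=> n x; rewrite gf; exact: path_coding_step.
- by move=> n d x; exact: path_coding_proj.
- move=> n x.
  exact: (@homeo_fun_continuous _ _ g x _ (path_coding_locally_constant n (g x))).
- by move=> x y /path_coding_inj /(can_inj (homeo_funK g)).
Defined.

(** * Expansiveness *)

Section Expansive.
Local Open Scope classical_set_scope.
Variables (R : realType) (X : metricType R) (f : homeo X X) (T : tower_coding f).
Hypothesis cptX : compact [set: X].

(** A Lebesgue number for the partition of [X] by a locally constant coding. *)
Lemma coding_uniform n : exists2 e : R, (0 < e)%R &
  forall x y, (mdist x y <= e)%R -> coding T n x = coding T n y.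
Proof.
pose P (e : R) x := forall y, (mdist x y <= e)%R -> coding T n x = coding T n y.
have nearP : \forall e \near ((0 : R)^'+)%R, [set: X] `<=` P e.
  apply: (proj1 (compact_near_coveringP _) cptX).
  move=> x _; have /nbhs_ballP[r /= r0 rP] := coding_locally_constant T n x.
  have r20 : (0 < r / 2)%R by rewrite divr_gt0.
  exists (ball x (r / 2)%R, [set e : R | (e < r / 2)%R]).
    by split; [exact: nbhsx_ballx|exact: nbhs_right_lt].
  move=> [x' e] [/= xx' er] y xy.
  have xx'r : ball x r x'.
    by apply: le_ball xx'; rewrite ler_pdivrMr// ler_pMr// ler1n.
  rewrite [LHS](rP x' xx'r).
  apply/esym/rP; rewrite (splitr r); apply: ball_triangle xx' _.
  by rewrite ballEmdist /=; exact: le_lt_trans er.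
have [e [e0 eP]] := filter_ex (filterI (nbhs_right_gt (0 : R)%R) nearP).
by exists e => // x y; exact: eP.
Qed.

Lemma not_expansive_same_row n : ~ expansive f ->
  exists xy : X * X, xy.1 <> xy.2 /\ same_row T n xy.1 xy.2.
Proof.
move=> nexp; apply: contrapT => /forallNP no; apply: nexp.
have [e e0 eP] := coding_uniform n; exists e => // x y xy.
apply: contrapT => /forallNP close; apply: (no (x, y)); split => //= k.
by apply: eP; rewrite leNgt; apply/negP; exact: close.
Qed.

Theorem tower_coding_expansive K : bounded_rank T K ->
  (forall M : set X, minimal_set f M -> ~ odometer_on f M) -> expansive f.
Proof.
move=> rankK no_odometer; apply: contrapT => nexp.
have period_le n m p x : n <= m -> row_period T m p x -> row_period T n p x.
  by move=> nm /row_periodP E; apply/row_periodP; exact: same_row_le E.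
have [N NP] := same_row_periodic rankK.
(* The pair is taken at level [maxn n N], where [same_row_periodic] applies, and its properties are
   then lowered to [n]. *)
have /choice[w wP] : forall n, exists w : X * X * nat,
    [/\ w.1.1 <> w.1.2, same_row T n w.1.1 w.1.2, 0 < w.2 & row_period T n w.2 w.1.1].
  move=> n; have [[x y] [/= xy xyE]] := not_expansive_same_row (maxn n N) nexp.
  have [p p0 px] := NP _ (leq_maxr n N) x y xyE xy.
  exists (x, y, p); split => //=.
    exact: same_row_le (leq_maxl n N) xyE.
  exact: period_le (leq_maxl n N) px.
pose x n := (w n).1.1; pose y n := (w n).1.2; pose p n := (w n).2.
have /choice[Ms MsP] : forall n, exists M,
    minimal_set f M /\ M `<=` row_orbit T n (x n).
  move=> n; have [_ _ p0 px] := wP n.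
  have [M minM Mx] := closed_invariant_minimal cptX
    (closed_invariant_row_orbit p0 px).
  by exists M.
have [M MsM] := minimal_sets_finite cptX rankK (fun n => (MsP n).1).
have minM : minimal_set f M by have [m _ <-] := MsM 0; have [] := MsP m.
have ciM : closed_invariant f M by have [] := minM.
have [z Mz] : M !=set0 by have [] := ciM.
have Mx n : exists2 m, n <= m & M `<=` row_orbit T m (x m).
  by have [m nm <-] := MsM n; exists m => //; have [] := MsP m.
have periodic n : exists2 p, 0 < p & row_period T n p z.
  have [m nm /(_ z Mz)[i zi]] := Mx n; have [_ _ p0 px] := wP m.
  exists (p m) => //; apply: (period_le _ _ _ _ nm); apply/row_periodP.
  apply: same_row_trans (same_row_sym zi).
  apply: (same_row_trans (same_row_iterz (Posz (p m)) zi)).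
  rewrite -iterzD addrC iterzD; apply: same_row_iterz.
  exact/row_periodP.
have orbit_rows n y' : M y' -> exists i, same_row T n y' (iterz f i z).
  move=> My; have [m nm MO] := Mx n; have [_ _ p0 px] := wP m.
  have [i yi] := minimal_row_orbit p0 px minM MO My Mz.
  by exists i; exact: same_row_le yi.
have [[q q0 qz]|unbounded] :=
  pselect (exists2 q, 0 < q & forall n, row_period T n q z); last first.
  exact: no_odometer minM (minimal_odometer cptX ciM Mz periodic orbit_rows unbounded).
have fqz : iterz f (Posz q) z = z.
  by apply: (same_row_eq (T := T)) => n; exact/row_periodP.
apply: (periodic_isolated rankK q0 fqz) => n.
have [m nm /(_ z Mz)[i zi]] := Mx n; have [xy xyE _ _] := wP m.
(* Shifted by [i], both points of the pair have the row of [z] at level [m]; as they are distinct,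
   one of them is not [z]. *)
have [xz|xz] := pselect (iterz f i (x m) = z); last first.
  by exists (iterz f i (x m)) => //; apply: same_row_le nm (same_row_sym zi).
exists (iterz f i (y m)).
  move=> yz; apply: xy; rewrite -[LHS](iterzK f (- i)) -[RHS](iterzK f (- i)).
  by rewrite opprK -/(x m) -/(y m) xz yz.
apply: (same_row_le nm); apply: same_row_trans (same_row_sym zi).
exact/same_row_sym/same_row_iterz.
Qed.

End Expansive.

(** Otherwise, for every real [a], the sizes exceed [a] from some level on, and the inferior limit
    is infinite. *)
Lemma bratteli_rank_bounded (R : realType) (B : bratteli) :
  (bratteli_rank R B < +oo)%E ->
  exists K, forall n, exists2 m, n <= m & #|vertex B m| <= K.
Proof.
move=> lty; apply: contrapT => /forallNP unbounded.
suff E : bratteli_rank R B = +oo%E by rewrite E in lty.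
rewrite /bratteli_rank limn_einf_lim (cvg_lim _ (@cvg_einfs_sup R _))//.
apply/eqyP => a a0.
have /existsNP[n nP] := unbounded (Num.bound a).
apply: le_ereal_sup_tmp; eexists; first by exists n.
apply: le_ereal_inf_tmp => _ [m /= nm <-].
rewrite lee_fin (le_trans (ltW (archi_boundP (ltW a0))))// ler_nat leqNgt.
by apply/negP => lt; apply: nP; exists m => //; exact: ltnW.
Qed.

Unset Implicit Arguments.

Local Open Scope classical_set_scope.

Theorem theorem4p4 (R : realType) (X : metricType R) (f : homeo X X)
    (cptX : compact [set: X]) (zdX : zero_dimensional X)
    (rank_f : (topological_rank R f < +oo)%E)
    (no_odometer : forall M : set X, minimal_set f M -> ~ odometer_on f M) :
  expansive f.
Proof.
have [_ [B [phi [vershik [g gf]]] <-] B_rank] := ereal_inf_lt rank_f.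
have [K rankK] := bratteli_rank_bounded B_rank.
exact: (@tower_coding_expansive R X f (representation_coding vershik gf) cptX K).
Qed.
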